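(* For all $s\ge 3$ and $n\ge 1$, $r(L_{K_s}, K_{n,n,n}^{(3)}) = \binom{n+s}{s}^{\Theta(n)}$, where the implicit constants in the exponent are absolute (they do not depend on $s$ or $n$).
   Context: A $3$-graph is a $3$-uniform hypergraph. For $3$-graphs $H_1,H_2$, $r(H_1,H_2)$ is the smallest $N$ such that every $3$-graph on $N$ vertices contains a copy of $H_1$ or its complement contains a copy of $H_2$. $K_s$ is the complete graph on $s$ vertices. For a graph $G$, its link hypergraph $L_G$ is the $3$-graph on $V(G)\cup\{u\}$ ($u$ a new vertex) whose edges are the triples $\{u,v,w\}$ with $\{v,w\}\in E(G)$. $K_{n,n,n}^{(3)}$ is the complete tripartite $3$-graph with three parts of size $n$, whose edges are exactly the triples with one vertex in each part. *)

(* Defs.v *)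
From mathcomp Require Import all_boot.

Set Implicit Arguments.
Unset Strict Implicit.
Unset Printing Implicit Defensive.

Record hypergraph (k : nat) (V : finType) := Hypergraph {
  edges : {set {set V}};
  edges_card : forall e, e \in edges -> #|e| = k
}.

Notation graph := (hypergraph 2).
Notation graph3 := (hypergraph 3).

Lemma complete_card (k : nat) (V : finType) (e : {set V}) :
  e \in [set e : {set V} | #|e| == k] -> #|e| = k.
Proof. by rewrite inE => /eqP. Qed.

Definition complete (k : nat) (V : finType) : hypergraph k V :=
  Hypergraph (@complete_card k V).

Lemma complement_card (k : nat) (V : finType) (G : hypergraph k V) e :
  e \in [set e : {set V} | (#|e| == k) && (e \notin edges G)] -> #|e| = k.
Proof. by rewrite inE => /andP[/eqP]. Qed.

Definition complement (k : nat) (V : finType) (G : hypergraph k V) :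
  hypergraph k V := Hypergraph (@complement_card k V G).

(* Copies are not required to be induced. *)
Definition has_copy (k : nat) (V W : finType)
    (H : hypergraph k V) (G : hypergraph k W) : Prop :=
  exists2 f : V -> W, injective f &
    forall e, e \in edges H -> f @: e \in edges G.

Definition ramsey_prop (V1 V2 : finType) (H1 : graph3 V1) (H2 : graph3 V2)
    (N : nat) : Prop :=
  forall G : graph3 'I_N, has_copy H1 G \/ has_copy H2 (complement G).

Definition is_ramsey_number (V1 V2 : finType)
    (H1 : graph3 V1) (H2 : graph3 V2) (N : nat) : Prop :=
  ramsey_prop H1 H2 N /\ forall M, ramsey_prop H1 H2 M -> N <= M.

Definition K (s : nat) : graph 'I_s := complete 2 'I_s.

Lemma link_card (V : finType) (G : graph V) e :
  e \in [set None |: [set Some x | x in (d : {set V})] | d in edges G] ->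
  #|e| = 3.
Proof.
case/imsetP=> d /edges_card d2 ->.
rewrite cardsU1 (card_imset _ Some_inj) d2.
by case: imsetP => // -[].
Qed.

(* The new vertex u is None. *)
Definition link (V : finType) (G : graph V) : graph3 (option V) :=
  Hypergraph (@link_card V G).

Lemma tripartite_card (n : nat) e :
  e \in [set e : {set 'I_3 * 'I_n} |
          (#|e| == 3) && [forall i, #|[set x in e | x.1 == i]| == 1]] ->
  #|e| = 3.
Proof. by rewrite inE => /andP[/eqP]. Qed.

(* The vertex (i, j) is the j-th vertex of the i-th part. *)
Definition tripartite (n : nat) : graph3 ('I_3 * 'I_n)%type :=
  Hypergraph (@tripartite_card n).

(* Main.v *)
(**
Upper bound.  Put M = 'C(2n + s, s), so that by Erdos and Szekeres every link,
restricted to a fixed set of M vertices, contains K_s or an independent set of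
size 2n.  If no link contains K_s, then by pigeonhole n vertices outside the
fixed set share the same independent set, which gives K_{n,n,n} in the
complement as soon as there are about n M^(2n) vertices.

Lower bound.  Colour the ordered pairs of vertices independently and uniformly
by the vertices of an auxiliary K_s-free graph F; a condition
"chi(u, v) and chi(u, w) are adjacent in F" at the vertex u makes the link of u
homomorphic to F.  The point is to show that three blocks of size n span no
edge with probability |V(F)|^(-c n^2), and not merely 2^(-c n^2); then a union
bound allows |V(F)|^(c' n) vertices.

- If s is large, order the vertices and impose the condition only at the
  smallest and at the largest vertex of a triple: the pairs having v as the
  middle vertex form a bipartite graph, so the link of v has clique number at
  most 2 omega(F).  Here F is a random graph of density 2^-j or 1 - 2^-j,
  according to whether s <= n or s >= n.  For a in the first and c in the last
  block, either all but a |V|^-c fraction of the pairs (chi(a, c), chi(c, a))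
  create an edge with some b, or the colours chi(a, b), chi(c, b) are confined
  to a small set, which happens with probability |V|^(-c n).
- If s is bounded, it suffices to take F triangle-free on n^c vertices without
  large bipartite holes, and to impose the condition at all three vertices.
*)
Require Import Defs.
From mathcomp Require Import all_boot all_order all_algebra.
From mathcomp Require Import reals exp.
From mathcomp Require Import boolp ring zify.

Set Implicit Arguments.
Unset Strict Implicit.
Unset Printing Implicit Defensive.

(** * Counting colourings with constrained blocks *)

Lemma card_powersets (T : finType) : #|{set T}| = 2 ^ #|T|.
Proof. by rewrite -[LHS]cardsT -powersetT card_powerset cardsT. Qed.

Section Counting.

Variables (I V : finType).

(* The blocks of coordinates pos (l, _) are disjoint, and the set in which block l
   is confined may depend on all coordinates outside the blocks: this is how one
   conditions on the colours revealed so far. *)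
Lemma card_blocks (L K : finType) (pos : L * K -> I) (D : {set L}) (X T : nat)
    (S : {ffun I -> V} -> L -> {set {ffun K -> V}}) :
  injective pos ->
  (forall p q : {ffun I -> V}, (forall i, i \notin codom pos -> p i = q i) ->
     forall l, S p l = S q l) ->
  (forall p l, #|S p l| * X <= #|V| ^ #|K| * T) ->
  #|[set p : {ffun I -> V} |
      [forall l in D, [ffun k => p (pos (l, k))] \in S p l]]| * X ^ #|D|
    <= T ^ #|D| * #|V| ^ #|I|.
Proof.
move=> pos_inj Sdep Scard; set E := [set p | _].
case: (set_0Vmem E) => [->|[p0 _]]; first by rewrite cards0 mul0n.
(* [er] resets the block coordinates to those of the fixed [p0], so its fibres consist of the
   choices inside the blocks. The fibre over q embeds through [Psi] into the product [G q], because
   S depends only on what [er] keeps. *)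
pose c := codom pos.
pose er (p : {ffun I -> V}) := [ffun i => if i \in c then p0 i else p i].
pose D0 : {pred {ffun I -> V}} :=
  family (fun i => if i \in c then pred1 (p0 i) else predT).
pose G q : {pred {ffun L -> {ffun K -> V}}} :=
  family (fun l => if l \in D then [pred x in S q l] else predT).
have cardD0 : #|D0| * (#|V| ^ #|K|) ^ #|L| = #|V| ^ #|I|.
  rewrite card_family foldrE big_image /=.
  rewrite (eq_bigr (fun i => if i \in c then 1 else #|V|)); last first.
    by move=> i _; case: ifP => _; rewrite ?card1 // cardT -cardT.
  rewrite (bigID (fun i => i \in c)) /= big1; last by move=> i ->.
  rewrite mul1n (eq_bigr (fun=> #|V|)); last by move=> i /negPf ->.
  rewrite (_ : \prod_(i | _) #|V| = \prod_(i in [predC c]) #|V|); last first.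
    by apply: eq_bigl => i; rewrite inE.
  rewrite prod_nat_const -expnM -expnD -(cardC (mem c)) addnC; congr (_ ^ (_ + _)).
  by rewrite card_codom // card_prod mulnC.
have cardG q : #|G q| * X ^ #|D| <= (#|V| ^ #|K|) ^ #|L| * T ^ #|D|.
  have -> : (#|V| ^ #|K|) ^ #|L| = \prod_(l : L) #|V| ^ #|K|.
    by rewrite -prod_nat_const; apply: eq_bigl.
  rewrite card_family foldrE big_image /= -[X ^ _]prod_nat_const -[T ^ _]prod_nat_const.
  rewrite [X in _ * X <= _]big_mkcond [X in _ <= _ * X]big_mkcond /=.
  rewrite -!big_split /=.
  apply: leq_prod => l _.
  case: ifP => _.
    by apply: leq_trans (Scard q l); rewrite leq_mul2r subset_leq_card ?orbT.
  by rewrite !muln1 cardT -cardT card_ffun.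
rewrite -cardD0 mulnCA [T ^ _ * _]mulnC -sum1_card (partition_big er (mem D0)) /=; last first.
  move=> p _; apply/familyP => i; rewrite ffunE; case: (i \in c); rewrite ?inE //.
rewrite big_distrl /= -sum_nat_const; apply: leq_sum => q _.
apply: leq_trans (cardG q); rewrite leq_mul2r; apply/orP; right.
rewrite sum1_card.
pose Psi (p : {ffun I -> V}) := [ffun l => [ffun k => p (pos (l, k))]].
rewrite -(card_in_imset (f := Psi)).
  apply: subset_leq_card; apply/subsetP => _ /imsetP[p + ->].
  rewrite unfold_in => /andP[]; rewrite inE => /forall_inP pE /eqP pq; apply/familyP => l.
  rewrite ffunE; case: ifP => // lD; rewrite inE.
  rewrite -(@Sdep p q); first exact: pE.
  by move=> i ni; rewrite -pq ffunE (negPf ni).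
move=> p p'; rewrite !unfold_in => /andP[_ /eqP pq] /andP[_ /eqP p'q] eqP.
apply/ffunP => i; case ci: (i \in c); last first.
  by move: (congr1 (fun f : {ffun _} => f i) (etrans pq (esym p'q)));
    rewrite !ffunE ci.
have /codomP[[l k] ->] := ci.
by move: (congr1 (fun f : {ffun _} => (f l : {ffun _}) k) eqP); rewrite !ffunE.
Qed.

(** Union bound. Throughout, a probability at most a / X for an event E is stated without division,
    as [#|E| * X <= a * #|V| ^ #|I|]. *)
Lemma card_exists (J : finType) (Q : pred J) (P : J -> pred {ffun I -> V})
    (c m : nat) :
  (forall j, Q j -> #|[set p | P j p]| * c <= m) ->
  #|[set p | [exists j, Q j && P j p]]| * c <= #|Q| * m.
Proof.
move=> PS; apply: (@leq_trans ((\sum_(j | Q j) #|[set p | P j p]|) * c)).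
  rewrite leq_mul2r; apply/orP; right.
  apply: (@leq_trans #|\bigcup_(j | Q j) [set p | P j p]|).
    apply: subset_leq_card; apply/subsetP => p; rewrite inE => /existsP[j /andP[Qj Pj]].
    by apply/bigcupP; exists j => //; rewrite inE.
  elim/big_ind2: _ => [|x a y b xa yb|//]; first by rewrite cards0.
  by rewrite (leq_trans (leq_card_setU _ _)) ?leq_add.
by rewrite big_distrl /= -sum_nat_const; apply: leq_sum.
Qed.

(** Union bound over the set D of d blocks that are confined, at the price of a factor 2^|L|. *)
Lemma card_many_blocks (L K : finType) (pos : L * K -> I) (d X : nat)
    (S : {ffun I -> V} -> L -> {set {ffun K -> V}}) :
  injective pos ->
  (forall p q : {ffun I -> V}, (forall i, i \notin codom pos -> p i = q i) ->
     forall l, S p l = S q l) ->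
  (forall p l, #|S p l| * X <= #|V| ^ #|K|) ->
  #|[set p : {ffun I -> V} |
      d <= #|[set l | [ffun k => p (pos (l, k))] \in S p l]|]| * X ^ d
    <= 2 ^ #|L| * #|V| ^ #|I|.
Proof.
move=> pos_inj Sdep Scard.
pose P (D : {set L}) := [pred p : {ffun I -> V} |
  [forall l in D, [ffun k => p (pos (l, k))] \in S p l]].
have H (D : {set L}) : #|D| == d -> #|[set p | P D p]| * X ^ d <= #|V| ^ #|I|.
  move=> /eqP <-; rewrite -[leqRHS]mul1n -(exp1n #|D|).
  by apply: card_blocks => // p l; rewrite muln1.
apply: leq_trans (leq_trans (card_exists H) _); last first.
  rewrite leq_mul2r; apply/orP; right; apply: leq_trans (max_card _) _.
  by rewrite card_powersets.
rewrite leq_mul2r; apply/orP; right; apply: subset_leq_card.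
apply/subsetP => p; rewrite !inE => dle.
have [D] := card_geqP dle.
case=> uD sD DS; apply/existsP; exists [set x in D].
rewrite cardsE (card_uniqP uD) sD eqxx /=; apply/forall_inP => l.
by rewrite inE => /DS; rewrite inE.
Qed.

End Counting.

Section SmallBlocks.

Variables (I V L : finType).

Lemma card_many_pairs (pos : L * bool -> I) (d X : nat)
    (S : {ffun I -> V} -> L -> {set V * V}) :
  injective pos ->
  (forall p q : {ffun I -> V}, (forall i, i \notin codom pos -> p i = q i) ->
     forall l, S p l = S q l) ->
  (forall p l, #|S p l| * X <= #|V| ^ 2) ->
  #|[set p : {ffun I -> V} |
      d <= #|[set l | (p (pos (l, false)), p (pos (l, true))) \in S p l]|]|
    * X ^ d <= 2 ^ #|L| * #|V| ^ #|I|.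
Proof.
move=> pos_inj Sdep Scard.
pose S' p l := [set r : {ffun bool -> V} | (r false, r true) \in S p l].
have /= := @card_many_blocks I V L bool pos d X S' pos_inj.
have -> : [set p : {ffun I -> V} |
    d <= #|[set l | [ffun k => p (pos (l, k))] \in S' p l]|] =
    [set p : {ffun I -> V} | d <= #|[set l | (p (pos (l, false)), p (pos (l, true))) \in S p l]|].
  apply/setP => p; rewrite !inE; congr (d <= #|pred_of_set _|).
  by apply/setP => l; rewrite !inE !ffunE.
apply=> [p q pq l|p l]; first by rewrite /S' (Sdep p q).
rewrite card_bool; apply: leq_trans (Scard p l); rewrite leq_mul2r.
apply/orP; right; rewrite -(card_imset (f := fun r : {ffun bool -> V} => (r false, r true))).
  by apply: subset_leq_card; apply/subsetP => _ /imsetP[r + ->]; rewrite inE.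
by move=> r r' [e1 e2]; apply/ffunP => -[].
Qed.

Lemma card_many_points (pos : L -> I) (d X : nat)
    (S : {ffun I -> V} -> L -> {set V}) :
  injective pos ->
  (forall p q : {ffun I -> V}, (forall i, i \notin codom pos -> p i = q i) ->
     forall l, S p l = S q l) ->
  (forall p l, #|S p l| * X <= #|V|) ->
  #|[set p : {ffun I -> V} | d <= #|[set l | p (pos l) \in S p l]|]|
    * X ^ d <= 2 ^ #|L| * #|V| ^ #|I|.
Proof.
move=> pos_inj Sdep Scard.
pose S' p l := [set r : {ffun unit -> V} | r tt \in S p l].
pose pos' (x : L * unit) := pos x.1.
have pos'_inj : injective pos' by move=> [l []] [l' []] /pos_inj /= ->.
have /= := @card_many_blocks I V L unit pos' d X S' pos'_inj.
have -> : [set p : {ffun I -> V} |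
    d <= #|[set l | [ffun k => p (pos' (l, k))] \in S' p l]|] =
    [set p : {ffun I -> V} | d <= #|[set l | p (pos l) \in S p l]|].
  apply/setP => p; rewrite !inE; congr (d <= #|pred_of_set _|).
  by apply/setP => l; rewrite !inE !ffunE.
apply=> [p q pq l|p l].
  rewrite /S' (Sdep p q) // => i ni; apply: pq; apply: contra ni.
  by case/codomP=> -[l' u] ->; apply: codom_f.
rewrite card_unit; apply: leq_trans (Scard p l); rewrite leq_mul2r.
apply/orP; right; rewrite -(card_imset (f := fun r : {ffun unit -> V} => r tt)).
  by apply: subset_leq_card; apply/subsetP => _ /imsetP[r + ->]; rewrite inE.
by move=> r r' e1; apply/ffunP => -[].
Qed.

End SmallBlocks.

(* The shifts split the pairs into perfect matchings.  Events attached to the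
   pairs of one matching involve disjoint sets of coordinates. *)
Lemma exists_shift (n : nat) (D : {set 'I_n.+1 * 'I_n.+1}) (d : nat) :
  d * n.+1 <= #|D| ->
  exists j : 'I_n.+1, d <= #|[set a | (a, (a + j)%R) \in D]|.
Proof.
move=> dD; apply/existsP; apply: contraLR dD; rewrite negb_exists => /forallP H.
have [d0|d_gt0] := posnP d; first by have := H ord0; rewrite d0.
rewrite -ltnNge -sum1_card.
rewrite (partition_big (fun x : 'I_n.+1 * 'I_n.+1 => (x.2 - x.1)%R) xpredT) //=.
apply: (@leq_ltn_trans (\sum_(j < n.+1) d.-1)).
  apply: leq_sum => j _; have := H j; rewrite -ltnNge => Hj.
  rewrite -ltnS (prednK d_gt0); apply: leq_ltn_trans Hj.
  rewrite sum1_card -[leqRHS](card_imset (f := fun a => (a, (a + j)%R))).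
    apply: subset_leq_card; apply/subsetP => -[a c]; rewrite unfold_in /= => /andP[aD /eqP e].
    apply/imsetP; exists a; first by rewrite inE -e GRing.addrC GRing.subrK.
    by rewrite -e GRing.addrC GRing.subrK.
  by move=> a a' [].
by rewrite sum_nat_const card_ord mulnC ltn_mul2r /= prednK.
Qed.

(** * Graphs without large bipartite holes *)

Lemma card_fst_slices (T1 T2 : finType) (A : {set T1 * T2}) :
  #|A| = \sum_x #|[set y | (x, y) \in A]|.
Proof.
rewrite -sum1_card (partition_big fst xpredT) //=; apply: eq_bigr => x _.
rewrite sum1_card -[RHS](card_imset (f := fun y => (x, y))); last by move=> y y' [].
apply: eq_card => -[x' y]; rewrite unfold_in /=; apply/andP/imsetP.
  by case=> xA /eqP e; exists y; rewrite ?inE -e.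
by case=> y'; rewrite inE => yA [-> ->]; split.
Qed.

Lemma card_snd_slices (T1 T2 : finType) (A : {set T1 * T2}) :
  #|A| = \sum_y #|[set x | (x, y) \in A]|.
Proof.
rewrite -sum1_card (partition_big snd xpredT) //=; apply: eq_bigr => y _.
rewrite sum1_card -[RHS](card_imset (f := fun x => (x, y))); last by move=> x x' [].
apply: eq_card => -[x y']; rewrite unfold_in /=; apply/andP/imsetP.
  by case=> xA /eqP e; exists x; rewrite ?inE -e.
by case=> x'; rewrite inE => yA [-> ->]; split.
Qed.

(** Terms below k contribute at most |T| k in total and the others at most b each. A large sum
    therefore forces many terms to reach k. *)
Lemma sum_threshold (T : finType) (f : T -> nat) (b k : nat) :
  (forall x, f x <= b) ->
  \sum_x f x <= #|[set x | k <= f x]| * b + #|T| * k.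
Proof.
move=> fb; rewrite (bigID (fun x => k <= f x)) /=; apply: leq_add.
  rewrite cardsE -sum_nat_const; apply: leq_sum => x _; exact: fb.
apply: (@leq_trans (\sum_(x | ~~ (k <= f x)) k)).
  by apply: leq_sum => x; rewrite -ltnNge => /ltnW.
by rewrite sum_nat_const leq_mul2r max_card orbT.
Qed.

(** As long as b elements are uncovered, some [H a] covers w further ones; since [#|B| <= k * w],
    this happens at most k times. *)
Lemma greedy_cover (T1 T2 : finType) (H : T1 -> {set T2}) (A : {set T1})
    (w b k : nat) (B : {set T2}) :
  0 < b ->
  (forall B' : {set T2}, b <= #|B'| -> exists2 a, a \in A & w <= #|H a :&: B'|) ->
  #|B| <= k * w ->
  exists l : seq T1, [/\ size l <= k, {subset l <= A} &
    #|[set y in B | ~~ has (fun a => y \in H a) l]| < b].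
Proof.
move=> b_gt0 HA; elim: k B => [|k IHk] B Bk.
  exists [::]; split=> //; apply: leq_ltn_trans b_gt0.
  move: Bk; rewrite mul0n; apply: leq_trans.
  by apply/subset_leq_card/subsetP => y; rewrite inE => /andP[].
have [bB|Bb] := leqP b #|B|; last first.
  exists [::]; split=> //; apply: leq_ltn_trans Bb.
  by apply/subset_leq_card/subsetP => y; rewrite inE => /andP[].
have [a aA wa] := HA B bB.
have [|l [lk lA lB]] := IHk (B :\: H a).
  by move: wa Bk; rewrite -(cardsID (H a) B) setIC mulSn; lia.
exists (a :: l); split=> //= [x|]; first by rewrite inE => /predU1P[->//|/lA].
apply: leq_ltn_trans lB; apply/subset_leq_card/subsetP => y.
by rewrite !inE negb_or => /andP[-> /andP[-> ->]].
Qed.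

Section Holes.

Variables (V : finType) (F : rel V) (h : nat).
Hypothesis h_gt0 : 0 < h.
Hypothesis hole : forall X Y : {set V}, h <= #|X| -> h <= #|Y| ->
  exists x y, [/\ x \in X, y \in Y & F x y].

(** The tensor square of F has no large holes either. At least 2h first coordinates of Q have h
    continuations ([Y]), and symmetrically for the second coordinates of Z ([Z2]); the hole property
    of F is then used once in each coordinate. *)
Lemma tensor_hole (Q Z : {set V * V}) :
  0 < #|V| ->
  (forall p r, p \in Q -> r \in Z -> ~~ (F r.1 p.1 && F r.2 p.2)) ->
  3 * h * #|V| <= #|Q| -> #|Z| < 3 * h * #|V|.
Proof.
move=> V_gt0 QZ Qbig; rewrite ltnNge; apply/negP => Zbig.
pose Qy y := [set y' | (y, y') \in Q]; pose Zz z := [set x | (x, z) \in Z].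
pose Y := [set y | h <= #|Qy y|]; pose Z2 := [set z | h <= #|Zz z|].
have Y_big : 2 * h <= #|Y|.
  rewrite -(leq_pmul2r V_gt0); move: Qbig; rewrite card_fst_slices => Qbig.
  have := leq_trans Qbig (@sum_threshold _ (fun y => #|Qy y|) #|V| h (fun y => max_card _)).
  by rewrite -/Y; lia.
have Z2_big : 2 * h <= #|Z2|.
  rewrite -(leq_pmul2r V_gt0); move: Zbig; rewrite card_snd_slices => Zbig.
  have := leq_trans Zbig (@sum_threshold _ (fun z => #|Zz z|) #|V| h (fun z => max_card _)).
  by rewrite -/Z2; lia.
(* For fixed y in Y the relation [R y z] holds for fewer than h elements z of Z2; for fixed z in Z2
   it fails for fewer than h elements y of Y. Double counting contradicts |Y|, |Z2| >= 2h. *)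
pose R y z := ~~ [exists y' in Qy y, F z y'].
have Ry y : y \in Y -> #|[set z in Z2 | R y z]| < h.
  rewrite inE => yY; rewrite ltnNge; apply/negP => hR.
  have [z [y' [+ y'Q Fzy]]] := hole hR yY.
  rewrite inE => /andP[_ /existsP[]]; exists y'; exact/andP.
have Rz z : z \in Z2 -> #|[set y in Y | ~~ R y z]| < h.
  rewrite inE => zZ; rewrite ltnNge; apply/negP => hR.
  have [x [y [+ + Fxy]]] := hole zZ hR.
  rewrite !inE negbK => xZ /andP[_ /existsP[y' /andP[]]]; rewrite inE => yQ Fzy'.
  by have /negP[] := QZ _ _ yQ xZ; apply/andP.
have : \sum_(z in Z2) (#|Y| - h) <= \sum_(y in Y) h.-1.
  apply: (@leq_trans (\sum_(z in Z2) \sum_(y in Y | R y z) 1)).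
    apply: leq_sum => z /Rz; rewrite sum1dep_card -(cardsID [set y | R y z] Y).
    rewrite leq_subLR; have -> : Y :\: [set y | R y z] = [set y in Y | ~~ R y z].
      by apply/setP => y; rewrite !inE andbC.
    have -> : Y :&: [set y | R y z] = [set y in Y | R y z].
      by apply/setP => y; rewrite !inE.
    by move: #|_| #|_| => *; lia.
  rewrite (exchange_big_dep (mem Y)) /=; last by move=> z y _ /andP[].
  apply: leq_sum => y yY; have := Ry y yY; rewrite -sum1dep_card.
  have -> : \sum_(z in Z2 | (y \in Y) && R y z) 1 = \sum_(z in Z2 | R y z) 1.
    by apply: eq_bigl => z; rewrite yY.
  by move: (\sum_(_ | _) _) => *; lia.
rewrite !sum_nat_const; nia.
Qed.

(* Either half of the colours r (false, a) are confined to the few common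
   non-neighbours of the colours r (true, b), b in H a; or for half of the a the
   colours r (true, b), b in H a, take at most h values, and then t of these
   neighbourhoods already cover most b.  The second case costs only a choice of
   t sets of colours. *)
Lemma card_avoiding (n u t w k : nat) (H : 'I_n -> {set 'I_n}) :
  n = 4 * u -> 0 < u -> n <= t * w -> h * k <= #|V| ->
  (forall A' B' : {set 'I_n}, 2 * u <= #|A'| -> u <= #|B'| ->
     exists2 a, a \in A' & w <= #|H a :&: B'|) ->
  #|[set r : {ffun bool * 'I_n -> V} |
      [forall a, forall b in H a, ~~ F (r (false, a)) (r (true, b))]]|
    * k ^ (2 * u)
  <= (2 ^ n + (n * 2 ^ #|V|) ^ t * 2 ^ n) * #|V| ^ (2 * n).
Proof.
move=> nu u_gt0 ntw hk rich.
pose U (r : {ffun bool * 'I_n -> V}) a :=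
  [set v | [forall b in H a, ~~ F v (r (true, b))]].
(* Replacing an oversized set by [set0] makes the size hypothesis of the counting lemmas hold for
   every colouring. The same device recurs below. *)
pose S1 r a := if #|U r a| <= h then U r a else set0.
pose E1 := [set r : {ffun bool * 'I_n -> V} |
  2 * u <= #|[set a | r (false, a) \in S1 r a]|].
(* [tau] guesses t indices a together with the set of colours r (true, b), b in H a, for each of
   them. A covered b is confined to the guessed set of one index that covers it. *)
pose S2 (tau : {ffun 'I_t -> 'I_n * {set V}}) (r : {ffun bool * 'I_n -> V}) b :=
  if [pick i | b \in H (tau i).1] is Some i then
    if #|(tau i).2| <= h then (tau i).2 else set0
  else set0.
pose E2 tau := [pred r : {ffun bool * 'I_n -> V} |
  2 * u <= #|[set b | r (true, b) \in S2 tau r b]|].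
have card_if (X : {set V}) : #|if #|X| <= h then X else set0| * k <= #|V|.
  apply: leq_trans hk; rewrite leq_mul2r; apply/orP; right.
  by case: ifP => // _; rewrite cards0.
have cardI : #|((bool * 'I_n)%type : finType)| = 2 * n.
  by rewrite card_prod card_bool card_ord.
have cE1 : #|E1| * k ^ (2 * u) <= 2 ^ n * #|V| ^ (2 * n).
  have := @card_many_points _ V 'I_n (fun a => (false, a)) (2 * u) k S1.
  rewrite card_ord cardI; apply=> [a a' []//|p q pq a|r a]; last exact: card_if.
  rewrite /S1; have -> // : U p a = U q a.
  apply/setP => v; rewrite !inE; apply: eq_forallb_in => b _.
  by rewrite pq //; apply/codomP => -[].
have cE2 : #|[set r | [exists tau, true && E2 tau r]]| * k ^ (2 * u) <=
    (n * 2 ^ #|V|) ^ t * (2 ^ n * #|V| ^ (2 * n)).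
  have -> : (n * 2 ^ #|V|) ^ t = #|(fun tau : {ffun 'I_t -> 'I_n * {set V}} => true)|.
    by rewrite (eq_card (B := predT)) // card_ffun card_prod card_powersets !card_ord.
  apply: card_exists => tau _.
  have := @card_many_points _ V 'I_n (fun b => (true, b)) (2 * u) k (S2 tau).
  rewrite card_ord cardI; apply=> [b b' []//|p q pq //|r b].
  rewrite /S2; case: pickP => [i _|_]; [exact: card_if|by rewrite cards0].
apply: (@leq_trans ((#|E1| + #|[set r | [exists tau, true && E2 tau r]]|) * k ^ (2 * u))); last first.
  by rewrite mulnDl mulnDl -mulnA; apply: leq_add.
rewrite leq_mul2r; apply/orP; right.
apply: leq_trans (leq_card_setU _ _); apply: subset_leq_card.
apply/subsetP => r; rewrite inE => /forallP avoid.
rewrite in_setU [r \in E1]inE [X in _ || X]inE.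
have [//|few /=] := leqP (2 * u) #|[set a | r (false, a) \in S1 r a]|.
pose A' := [set a | h <= #|U r a|].
have A'big : 2 * u <= #|A'|.
  have : [set: 'I_n] \subset A' :|: [set a | r (false, a) \in S1 r a].
    apply/subsetP => a _; rewrite !inE /S1; case: leqP => //= /ltnW ->.
    by rewrite inE avoid.
  move/subset_leq_card; rewrite cardsT card_ord.
  move/leq_trans/(_ (leq_card_setU _ _)) => le.
  have {le few} : n < #|A'| + 2 * u by rewrite (leq_ltn_trans le) // ltn_add2l.
  lia.
have smallY a : a \in A' -> #|[set r (true, b) | b in H a]| <= h.
  rewrite inE => aA'; rewrite leqNgt; apply/negP => /ltnW hY.
  have [v [y [+ /imsetP[b bH ->]]]] := hole aA' hY.
  by rewrite inE => /forall_inP/(_ b bH)/negP.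
have [|l [lt lA lB]] := @greedy_cover _ _ H A' w u t setT u_gt0 (fun B' => rich A' B' A'big);
  first by rewrite cardsT card_ord.
have [a0 a0A] : exists a0, a0 \in A' by apply/card_gt0P; lia.
(* The cover l may have fewer than t elements, whereas [tau] has exactly t entries; it is padded
   with [a0], which also lies in A'. *)
pose a_ i := nth a0 l i.
have aA i : a_ i \in A'.
  rewrite /a_; have [il|il] := ltnP i (size l); last by rewrite nth_default.
  by apply: lA; rewrite mem_nth.
pose tau := [ffun i : 'I_t => (a_ i, [set r (true, b) | b in H (a_ i)])].
apply/existsP; exists tau; rewrite /=.
have /subset_leq_card : [set: 'I_n] \subset [set b | r (true, b) \in S2 tau r b]
    :|: [set y in [set: 'I_n] | ~~ has (fun a => y \in H a) l].
  apply/subsetP => b _; rewrite !inE /=; case: hasP; last by rewrite orbT.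
  case=> a al bHa; rewrite orbF /S2; case: pickP => [i|none].
    by rewrite !ffunE /= => bHi; rewrite smallY //; apply/imsetP; exists b.
  have il : index a l < t by rewrite (leq_trans _ lt) // index_mem.
  by have := none (Ordinal il); rewrite ffunE /= /a_ nth_index ?bHa.
rewrite cardsT card_ord => /leq_trans/(_ (leq_card_setU _ _)) le.
have {le} : n < #|[set b | r (true, b) \in S2 tau r b]| + u.
  by rewrite (leq_ltn_trans le) // ltn_add2l.
by move: #|_| => m; lia.
Qed.

End Holes.

(** Absorbs the number c of choices in a union bound into the gain y, leaving the gain x. *)
Lemma leq_trade (a b c x y : nat) :
  0 < c -> a * y <= c * b -> c * x <= y -> a * x <= b.
Proof.
move=> c_gt0 aycb cxy; rewrite -(leq_pmul2l c_gt0); apply: leq_trans aycb.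
by rewrite mulnCA leq_mul2l cxy orbT.
Qed.

(** For an event covered by two events, each of probability at most 1 / (2x). *)
Lemma leq_halves (e e1 e2 x m : nat) :
  e <= e1 + e2 -> e1 * (2 * x) <= m -> e2 * (2 * x) <= m -> e * x <= m.
Proof.
move=> ee e1m e2m; rewrite -(@leq_pmul2l 2) // mulnCA.
apply: leq_trans (leq_mul ee (leqnn _)) _.
by rewrite mulnDl [2 * m]mul2n -addnn leq_add.
Qed.

(** * Three blocks with conditions at all three vertices *)

Section ThreeConditions.

Variables (V : finType) (F : rel V) (h k : nat).
Hypothesis h_gt0 : 0 < h.
Hypothesis hole : forall X Y : {set V}, h <= #|X| -> h <= #|Y| ->
  exists x y, [/\ x \in X, y \in Y & F x y].
Hypothesis V_gt0 : 0 < #|V|.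
Hypothesis hk : 3 * h * k <= #|V|.

(** In the application r gives the colours from some b and some a towards the vertices c, and y is a
    candidate for the colours of (b, a) and (a, b). *)
Definition sparse_pairs n (r : {ffun bool * 'I_n -> V}) (C : {set 'I_n}) w :=
  [set y : V * V |
    #|[set c in C | F (r (false, c)) y.1 && F (r (true, c)) y.2]| < w].

(** If many pairs are sparse, [tensor_hole] makes the set Z of colour pairs with no edge to them
    small. Each c in C coloured outside Z is counted by some sparse pair, so all but |V|^2 w
    elements of C are confined to Z. The factor 2^(|V|^2) pays for guessing Z. *)
Lemma card_many_sparse_pairs (n w d : nat) (C : {set 'I_n}) :
  d + #|V| ^ 2 * w <= #|C| ->
  #|[set r | #|V| ^ 2 < #|sparse_pairs r C w| * k]| * k ^ d <=
    2 ^ (#|V| ^ 2) * (2 ^ n * #|V| ^ (2 * n)).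
Proof.
move=> dC.
pose S (Z : {set V * V}) (r : {ffun bool * 'I_n -> V}) (c : 'I_n) :=
  if #|Z| * k <= #|V| ^ 2 then Z else set0.
pose E Z := [pred r : {ffun bool * 'I_n -> V} |
  d <= #|[set c | (r (false, c), r (true, c)) \in S Z r c]|].
have cE Z : true -> #|[set r | E Z r]| * k ^ d <= 2 ^ n * #|V| ^ (2 * n).
  move=> _.
  have := @card_many_pairs _ V 'I_n (fun x => (x.2, x.1)) d k (S Z).
  rewrite card_ord card_prod card_bool card_ord.
  apply=> [[x b] [x' b'] [-> ->]//|p q _ c //|r c].
  by rewrite /S; case: ifP => // _; rewrite cards0.
have {cE} := card_exists cE.
have -> : #|(fun _ : {set V * V} => true)| = 2 ^ (#|V| ^ 2).
  by rewrite (eq_card (B := predT)) // card_powersets card_prod mulnn.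
apply: leq_trans; rewrite leq_mul2r; apply/orP; right.
apply/subset_leq_card/subsetP => r; rewrite inE; set Q := sparse_pairs r C w => Qbig.
pose Z := [set v : V * V | [forall y in Q, ~~ (F v.1 y.1 && F v.2 y.2)]].
rewrite inE; apply/existsP; exists Z => /=.
have Zk : #|Z| * k <= #|V| ^ 2.
  have : #|Z| < 3 * h * #|V|.
    apply: (@tensor_hole V F h h_gt0 hole Q) => // [y v yQ|].
      by rewrite inE => /forall_inP; apply.
    rewrite leqNgt; apply/negP => Qsmall; move: Qbig; rewrite ltnNge => /negP[].
    apply: leq_trans (_ : 3 * h * #|V| * k <= _); first by rewrite leq_mul2r ltnW ?orbT.
    by rewrite mulnAC -mulnn leq_mul2r hk orbT.
  move=> Zs; apply: leq_trans (_ : 3 * h * #|V| * k <= _); first by rewrite leq_mul2r ltnW ?orbT.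
  by rewrite mulnAC -mulnn leq_mul2r hk orbT.
have : C \subset [set c | (r (false, c), r (true, c)) \in S Z r c] :|:
    \bigcup_(y in Q) [set c in C | F (r (false, c)) y.1 && F (r (true, c)) y.2].
  apply/subsetP => c cC; rewrite inE; rewrite inE /S Zk.
  case rZ: (_ \in Z) => //=; move: rZ; rewrite inE /= => /negbT.
  rewrite negb_forall_in => /exists_inP[y yQ]; rewrite negbK => Fy.
  by apply/bigcupP; exists y; rewrite // inE cC.
move/subset_leq_card/leq_trans => /(_ _ (leq_card_setU _ _)) => CD.
have UQ : #|\bigcup_(y in Q) [set c in C | F (r (false, c)) y.1 && F (r (true, c)) y.2]|
    <= #|V| ^ 2 * w.
  apply: leq_trans (_ : \sum_(y in Q) w <= _); last first.
    by rewrite sum_nat_const leq_mul2r -mulnn -card_prod max_card orbT.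
  apply: leq_trans (_ : \sum_(y in Q)
     #|[set c in C | F (r (false, c)) y.1 && F (r (true, c)) y.2]| <= _).
    elim/big_ind2: _ => [|x a y b xa yb|//]; first by rewrite cards0.
    by rewrite (leq_trans (leq_card_setU _ _)) ?leq_add.
  by apply: leq_sum => y; rewrite inE => /ltnW.
have := leq_trans (leq_trans dC CD) (leq_add (leqnn _) UQ).
by rewrite leq_add2r.
Qed.

Section Embedded.

(** The target probability is 1 / Y. One rich c misses all its edges with probability at most 1 /
    X3, and one pair (a, b) has too many sparse colour pairs with probability at most 1 / X6. The
    block size is a successor because shifts add indices in ['I_n.+1]. *)
Variables (N n z w t X3 X6 Y : nat) (a b c : 'I_n.+1 -> 'I_N).
Hypothesis a_inj : injective a.
Hypothesis b_inj : injective b.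
Hypothesis c_inj : injective c.
Hypothesis ab : forall i j, a i <> b j.
Hypothesis ac : forall i j, a i <> c j.
Hypothesis bc : forall i j, b i <> c j.

Hypothesis nz : n.+1 = 128 * z.
Hypothesis zw : z = 32 * (w * #|V| ^ 2).
Hypothesis tw : n.+1 <= t * w.
Hypothesis w_gt0 : 0 < w.
Hypothesis X3_small :
  (2 ^ n.+1 + (n.+1 * 2 ^ #|V|) ^ t * 2 ^ n.+1) * X3 <= k ^ (64 * z).
Hypothesis X6_small : 2 ^ (#|V| ^ 2) * 2 ^ n.+1 * X6 <= k ^ (2 * z).
Hypothesis Y3 : 4 * 2 ^ n.+1 * Y <= X3 ^ (64 * z).
Hypothesis Y5 : 2 ^ n.+1 * (4 ^ n.+1) ^ n.+1 * (4 * 2 ^ (n.+1 ^ 2)) * Y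
  <= k ^ (128 * z ^ 2).
Hypothesis Y6 : 2 ^ n.+1 * (4 ^ n.+1) ^ n.+1 * (n.+1 * (4 * 2 ^ n.+1)) * Y
  <= X6 ^ z.

Notation chiT := {ffun 'I_N * 'I_N -> V}.

Definition three_conditions (x : chiT) (u v w : 'I_N) :=
  [&& F (x (u, w)) (x (u, v)), F (x (v, w)) (x (v, u))
    & F (x (w, u)) (x (w, v))].

(** For j in this set, the triple of a_i, b_j, c_l is missing at most the condition at c_l. *)
Let H (x : chiT) l i := [set j | F (x (b j, c l)) (x (b j, a i)) &&
                                 F (x (a i, c l)) (x (a i, b j))].

(* The colours are revealed in the order (a, c), (b, c); then (a, b), (b, a); then
   (c, a), (c, b).  A rich c gains in the last step, and if many c are poor then
   the first two steps gain. *)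
Let rich x l := [forall A' : {set 'I_n.+1}, forall B' : {set 'I_n.+1},
  (64 * z <= #|A'|) ==> (32 * z <= #|B'|) ==>
  [exists i in A', w <= #|H x l i :&: B'|]].

Let z_gt0 : 0 < z. Proof. by rewrite zw !muln_gt0 w_gt0 V_gt0. Qed.

Let S3 x l : {set {ffun bool * 'I_n.+1 -> V}} :=
  if rich x l then [set r : {ffun bool * 'I_n.+1 -> V} |
    [forall i, forall j in H x l i,
    ~~ F (r (false, i)) (r (true, j))]] else set0.

Let pos3 (y : 'I_n.+1 * (bool * 'I_n.+1)) :=
  (c y.1, if y.2.1 then b y.2.2 else a y.2.2).

Let E3 := [set x : chiT |
  64 * z <= #|[set l | [ffun y => x (pos3 (l, y))] \in S3 x l]|].

Let card_E3 : #|E3| * (4 * Y) <= #|V| ^ (N * N).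
Proof.
have S3card x l : #|S3 x l| * X3 <= #|V| ^ #|((bool * 'I_n.+1)%type : finType)|.
  rewrite card_prod card_bool card_ord /S3; case: ifP => [r|_]; last by rewrite cards0.
  apply: (@leq_trade _ _ _ _ (k ^ (64 * z)) _ _ X3_small).
    by rewrite addn_gt0 expn_gt0.
  rewrite (_ : 64 * z = 2 * (32 * z)); last by lia.
  apply: (@card_avoiding V F h h_gt0 hole n.+1 (32 * z) t w k (H x l)) => //; [lia|lia| |].
    by apply: leq_trans hk; rewrite -mulnA leq_pmull.
  move=> A' B' A'z B'z; move/forallP/(_ A')/forallP/(_ B'): r.
  have -> /= : 64 * z <= #|A'| by apply: leq_trans A'z; lia.
  rewrite B'z /= => /exists_inP[i]; by exists i.
have pos3_inj : injective pos3.
  move=> [l [[] i]] [l' [[] i']] [] /c_inj -> /=.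
  - by move/b_inj ->.
  - by move/esym/ab.
  - by move/ab.
  - by move/a_inj ->.
have := @card_many_blocks _ V 'I_n.+1 _ pos3 (64 * z) X3 S3 pos3_inj _ S3card.
rewrite card_ord card_prod !card_ord -/E3 => cE3.
have {cE3} : #|E3| * X3 ^ (64 * z) <= 2 ^ n.+1 * #|V| ^ (N * N).
  apply: cE3 => p q pq l.
  (* [H] reads only colours of pairs that start outside the block c, while [pos3] ranges over pairs
     that start in it. *)
  have pq' (x y : 'I_N) : (forall l, x <> c l) -> p (x, y) = q (x, y).
    by move=> xc; apply: pq; apply/codomP => -[[l' y'] [/xc]].
  have HE : H p l = H q l.
    apply: funext => i; apply/setP => j; rewrite !inE.
    by rewrite !pq' //; (exact: bc) || (exact: ac).
  by rewrite /S3 /rich HE.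
move=> cE3; apply: (leq_trade _ cE3); first by rewrite expn_gt0.
by apply: leq_trans Y3; rewrite mulnA [2 ^ _ * 4]mulnC.
Qed.

Section Poor.

(** A guess of a set of poor indices l, with [AB l] the two sets witnessing that c_l is poor. All
    guesses together cost an exponential in n^2 with absolute base, which is affordable against
    gains of the form k^(c n^2). *)
Variables (R : {set 'I_n.+1}) (AB : {ffun 'I_n.+1 -> {set 'I_n.+1} * {set 'I_n.+1}}).

Let C' (ij : 'I_n.+1 * 'I_n.+1) := [set l in R | (ij.1 \in (AB l).1) && (ij.2 \in (AB l).2)].

Let rr (x : chiT) (ij : 'I_n.+1 * 'I_n.+1) := [ffun y : bool * 'I_n.+1 =>
  x (if y.1 then a ij.1 else b ij.2, c y.2)].

Let Q x ij := sparse_pairs (rr x ij) (C' ij) (64 * w).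

Let S5 x ij := if #|Q x ij| * k <= #|V| ^ 2 then Q x ij else set0.

Let pos5 (y : 'I_n.+1 * 'I_n.+1 * bool) :=
  if y.2 then (a y.1.1, b y.1.2) else (b y.1.2, a y.1.1).

Let E5 := [set x : chiT | 128 * z ^ 2 <=
  #|[set ij | (x (pos5 (ij, false)), x (pos5 (ij, true))) \in S5 x ij]|].

Let card_E5 : #|E5| * k ^ (128 * z ^ 2) <= 2 ^ (n.+1 ^ 2) * #|V| ^ (N * N).
Proof.
have pos5_inj : injective pos5.
  move=> [[i j] []] [[i' j'] []] [] /=.
  - by move=> /a_inj -> /b_inj ->.
  - by move/ab.
  - by move/esym/ab.
  - by move=> /b_inj -> /a_inj ->.
have := @card_many_pairs _ V _ pos5 (128 * z ^ 2) k S5 pos5_inj.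
rewrite !card_prod !card_ord mulnn -/E5; apply=> [p q pq ij|p ij]; last first.
  by rewrite /S5; case: ifP => // _; rewrite cards0.
suff rpq : rr p ij = rr q ij by rewrite /S5 /Q rpq.
apply/ffunP => -[e l]; rewrite !ffunE; apply: pq; apply/codomP => -[[ij' []]] [] _ /=.
  by move/esym/bc.
by move/esym/ac.
Qed.

Let S6 (j : 'I_n.+1) (x : chiT) (i : 'I_n.+1) : {set {ffun bool * 'I_n.+1 -> V}} :=
  if 4 * z <= #|C' (i, (i + j)%R)| then
    [set r | #|V| ^ 2 < #|sparse_pairs r (C' (i, (i + j)%R)) (64 * w)| * k]
  else set0.

Let pos6 (j : 'I_n.+1) (y : 'I_n.+1 * (bool * 'I_n.+1)) :=
  (if y.2.1 then a y.1 else b (y.1 + j)%R, c y.2.2).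

Let E6 j := [pred x : chiT | z <= #|[set i | [ffun y => x (pos6 j (i, y))] \in S6 j x i]|].

Let card_E6 : #|[set x | [exists j, true && E6 j x]]| * X6 ^ z
  <= n.+1 * (2 ^ n.+1 * #|V| ^ (N * N)).
Proof.
have e : #|(fun _ : 'I_n.+1 => true)| = n.+1.
  by rewrite (eq_card (B := predT)) // card_ord.
rewrite -[X in _ <= X * _]e; apply: card_exists => j _.
have pos6_inj : injective (pos6 j).
  move=> [i [[] l]] [i' [[] l']] [] /=.
  - by move=> /a_inj -> /c_inj ->.
  - by move/ab.
  - by move/esym/ab.
  - by move=> /b_inj/GRing.addIr -> /c_inj ->.
have := @card_many_blocks _ V _ _ (pos6 j) z X6 (S6 j) pos6_inj.
rewrite !card_prod !card_ord card_bool; apply=> // x i.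
rewrite /S6; case: ifP => [Cbig|_]; last by rewrite cards0.
apply: (@leq_trade _ _ _ _ (k ^ (2 * z)) _ _ X6_small).
  by rewrite muln_gt0 !expn_gt0.
rewrite -mulnA; apply: card_many_sparse_pairs; apply: leq_trans Cbig.
by rewrite {2}zw; lia.
Qed.

Definition poor := [&& 64 * z <= #|R| &
  [forall l in R, (64 * z <= #|(AB l).1|) && (32 * z <= #|(AB l).2|)]].

Let Epoor := [set x : chiT | [forall l in R, forall i in (AB l).1,
   #|H x l i :&: (AB l).2| < w] ].

(** Double counting over the pairs (i, j). At least 512 z^2 of them lie in the witnesses of 4z
    indices l ([P]). The witnesses of poverty allow at most 256 z^2 pairs to meet both conditions
    for 64w of these l ([NF]). For the remaining pairs the colours of (b_j, a_i) and (a_i, b_j) are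
    sparse: either they hit a small sparse set ([G5]), or the sparse set is large ([G6]), and then
    one shift carries z such pairs. *)
Lemma poor_cover : poor -> Epoor \subset E5 :|: [set x | [exists j, true && E6 j x]].
Proof.
case/andP => Rbig /forall_inP ABbig; apply/subsetP => x.
rewrite inE => /forall_inP Hsmall.
have sumC : (64 * z) * ((64 * z) * (32 * z)) <= \sum_ij #|C' ij|.
  have -> : \sum_ij #|C' ij| = \sum_(l in R) (#|(AB l).1| * #|(AB l).2|).
    under eq_bigr do rewrite -sum1_card.
    rewrite (exchange_big_dep (mem R)) /=; last by move=> ij l _; rewrite inE => /andP[].
    apply: eq_bigr => l lR; rewrite -cardsX -sum1_card; apply: eq_bigl => -[i j].
    by rewrite !inE lR.
  apply: leq_trans (_ : \sum_(l in R) ((64 * z) * (32 * z)) <= _).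
    by rewrite sum_nat_const leq_mul2r Rbig orbT.
  by apply: leq_sum => l /ABbig/andP[Al Bl]; apply: leq_mul.
pose W ij := [set l in C' ij | F (x (b ij.2, c l)) (x (b ij.2, a ij.1)) &&
                               F (x (a ij.1, c l)) (x (a ij.1, b ij.2))].
have sumW : \sum_ij #|W ij| <= (128 * z) * (128 * z * w).
  have -> : \sum_ij #|W ij| = \sum_(l in R) \sum_(i in (AB l).1) #|H x l i :&: (AB l).2|.
    under eq_bigr do rewrite -sum1_card.
    rewrite (exchange_big_dep (mem R)) /=; last first.
      by move=> ij l _; rewrite !inE => /andP[/andP[]].
    apply: eq_bigr => l lR; rewrite [RHS](eq_bigr (fun i => \sum_(j | j \in H x l i :&: (AB l).2) 1)).
      rewrite pair_big_dep /=; apply: eq_bigl => -[i j].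
      by rewrite !inE lR /= -!andbA; congr (_ && _); rewrite andbC -andbA.
    by move=> i _; rewrite sum1_card.
  apply: leq_trans (_ : \sum_(l in R) \sum_(i in (AB l).1) w <= _).
    apply: leq_sum => l lR; apply: leq_sum => i iA.
    by rewrite ltnW //; have /forall_inP := Hsmall l lR; apply.
  apply: leq_trans (_ : \sum_(l in R) (128 * z * w) <= _).
    apply: leq_sum => l _; rewrite sum_nat_const leq_mul2r -nz; apply/orP; right.
    by apply: leq_trans (max_card _) _; rewrite card_ord.
  rewrite sum_nat_const; apply: leq_trans (leq_mul (_ : _ <= 128 * z) (leqnn _)) _ => //.
  by apply: leq_trans (max_card _) _; rewrite card_ord nz.
pose P := [set ij | 4 * z <= #|C' ij|].
have Pbig : 512 * z ^ 2 <= #|P|.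
  have Cn ij : #|C' ij| <= n.+1 by apply: leq_trans (max_card _) _; rewrite card_ord.
  have := leq_trans sumC (sum_threshold (4 * z) Cn).
  rewrite -/P card_prod card_ord; move: #|P| => p; rewrite nz => le.
  rewrite -(@leq_pmul2r (128 * z)) ?muln_gt0 //.
  have e1 : 64 * z * (64 * z * (32 * z)) = 1024 * z ^ 2 * (128 * z) by ring.
  have e2 : 128 * z * (128 * z) * (4 * z) = 512 * z ^ 2 * (128 * z) by ring.
  move: le; rewrite e1 e2; move: (128 * z) (z ^ 2) => y1 y2; lia.
pose NF := [set ij | 64 * w <= #|W ij|].
have NFsmall : #|NF| <= 256 * z ^ 2.
  rewrite -(@leq_pmul2r (64 * w)) ?muln_gt0 //.
  apply: leq_trans (_ : \sum_(ij in NF) #|W ij| <= _).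
    by rewrite -sum_nat_const; apply: leq_sum => ij; rewrite inE.
  apply: leq_trans (_ : \sum_ij #|W ij| <= _); last first.
    apply: leq_trans sumW _.
    by have -> : 128 * z * (128 * z * w) = 256 * z ^ 2 * (64 * w) by ring.
  by rewrite [leqRHS](bigID (mem NF)) /= leq_addr.
pose G5 := [set ij | (x (pos5 (ij, false)), x (pos5 (ij, true))) \in S5 x ij].
pose G6 := [set ij in P | #|V| ^ 2 < #|Q x ij| * k].
have Pcov : P \subset NF :|: (G5 :|: G6).
  apply/subsetP => ij ijP; rewrite in_setU [ij \in NF]inE; case: leqP => //= Wsmall.
  rewrite in_setU [ij \in G6]inE ijP andTb; case: ltnP => [_|Qsmall]; first by rewrite orbT.
  rewrite orbF inE /S5 Qsmall inE; apply: leq_trans Wsmall; rewrite ltnS.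
  by apply/subset_leq_card/subsetP => l; rewrite !inE !ffunE.
have G56 : 256 * z ^ 2 <= #|G5| + #|G6|.
  have := leq_trans (subset_leq_card Pcov) (leq_card_setU _ _).
  have := (leq_card_setU G5 G6).1; lia.
rewrite in_setU; have [G5big|G5small] := leqP (128 * z ^ 2) #|G5|.
  by apply/orP; left; rewrite inE.
apply/orP; right; rewrite inE.
have G6big : 128 * z ^ 2 <= #|G6|.
  move: (leq_trans G56 (leq_add (ltnW G5small) (leqnn _))).
  by rewrite (_ : 256 * z ^ 2 = 128 * z ^ 2 + 128 * z ^ 2) ?leq_add2l // -mulnDl.
have [|j jG] := @exists_shift n G6 z.
  by apply: leq_trans G6big; rewrite [X in z * X]nz mulnCA mulnn.
apply/existsP; exists j => /=; apply: leq_trans jG _.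
apply/subset_leq_card/subsetP => i; rewrite !inE => /andP[iP iQ].
rewrite /S6 iP inE; move: iQ; rewrite /Q.
suff -> : rr x (i, (i + j)%R) = [ffun y => x (pos6 j (i, y))] by [].
by apply/ffunP => -[e l]; rewrite !ffunE.
Qed.

Lemma card_poor : poor ->
  #|Epoor| * (2 ^ n.+1 * (4 ^ n.+1) ^ n.+1 * (2 * Y)) <= #|V| ^ (N * N).
Proof.
move=> Qp; have {Qp} := leq_trans (subset_leq_card (poor_cover Qp)) (leq_card_setU _ _).
set e5 := #|E5|; set e6 := #|[set x | _]| => Ep.
apply: (leq_halves Ep).
  apply: (leq_trade _ card_E5); first by rewrite expn_gt0.
  apply: leq_trans Y5; rewrite leq_eqVlt; apply/orP; left; apply/eqP.
  by move: (2 ^ n.+1) ((4 ^ _) ^ _) (2 ^ (_ ^ _)) => *; ring.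
have c6 := card_E6; rewrite mulnA in c6.
apply: (leq_trade _ c6); first by rewrite muln_gt0 expn_gt0.
apply: leq_trans Y6; rewrite leq_eqVlt; apply/orP; left; apply/eqP.
by move: (n.+1) (2 ^ n.+1) ((4 ^ _) ^ _) => *; ring.
Qed.

End Poor.

(** When no triple satisfies the conditions, every rich c_l has its colours in [S3]. Hence either at
    least half of the c_l fall in [S3], or at least half are poor and some guess of witnesses is
    correct. *)
Lemma card_no_triple :
  #|[set x : chiT | [forall i, forall j, forall l,
      ~~ three_conditions x (a i) (b j) (c l)]]| * Y <= #|V| ^ (N * N).
Proof.
set E := [set x | _].
pose J := ({set 'I_n.+1} * {ffun 'I_n.+1 -> {set 'I_n.+1} * {set 'I_n.+1}})%type.
pose E4 (j : J) := [pred x : chiT | [forall l in j.1, forall i in (j.2 l).1,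
   #|H x l i :&: (j.2 l).2| < w]].
have cJ : #|(J : finType)| = 2 ^ n.+1 * (4 ^ n.+1) ^ n.+1.
  rewrite card_prod card_ffun card_prod !card_powersets card_ord.
  by congr (_ * _ ^ _); rewrite -expnMn.
have cE4 : #|[set x | [exists j : J, poor j.1 j.2 && E4 j x]]| * (2 * Y) <= #|V| ^ (N * N).
  have : #|[set x | [exists j : J, poor j.1 j.2 && E4 j x]]| * (#|(J : finType)| * (2 * Y))
      <= #|[pred j : J | poor j.1 j.2]| * #|V| ^ (N * N).
    by apply: card_exists => j jp; rewrite cJ; apply: card_poor.
  have J_gt0 : 0 < #|(J : finType)| by rewrite cJ muln_gt0 !expn_gt0.
  rewrite mulnCA => le; rewrite -(leq_pmul2l J_gt0); apply: leq_trans le _.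
  by rewrite leq_mul2r max_card orbT.
have cov : E \subset E3 :|: [set x | [exists j : J, poor j.1 j.2 && E4 j x]].
  apply/subsetP => x; rewrite inE => /forallP bad; rewrite in_setU [x \in E3]inE.
  case: leqP => //= few; rewrite inE.
  pose R := [set l | ~~ rich x l].
  pose pAB l := [pred AB : {set 'I_n.+1} * {set 'I_n.+1} |
    [&& 64 * z <= #|AB.1|, 32 * z <= #|AB.2| &
     [forall i in AB.1, #|H x l i :&: AB.2| < w]]].
  (* The default serves only indices outside R, where no witness exists. *)
  pose AB := [ffun l => odflt (set0, set0) [pick AB | pAB l AB]].
  have ABP l : l \in R -> pAB l (AB l).
    rewrite inE ffunE; case: pickP => //= none /negP[]; apply/forallP => A'; apply/forallP => B'.
    apply/implyP => A'z; apply/implyP => B'z; apply: contraFT (none (A', B')) => /= /exists_inPn H'.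
    by rewrite A'z B'z /=; apply/forall_inP => i /H'; rewrite -ltnNge.
  apply/existsP; exists (R, AB) => /=; apply/andP; split.
    apply/andP; split; last by apply/forall_inP => l /ABP/and3P[-> ->].
    have : [set: 'I_n.+1] \subset R :|: [set l | [ffun y => x (pos3 (l, y))] \in S3 x l].
      apply/subsetP => l _; rewrite !inE /S3; case: (rich x l) => //=; rewrite inE.
      apply/forallP => i; apply/forall_inP => j; rewrite inE !ffunE /= => /andP[H1 H2].
      by move/forallP/(_ j)/forallP/(_ l): (bad i); rewrite /three_conditions H1 H2.
    move/subset_leq_card; rewrite cardsT card_ord => /leq_trans/(_ (leq_card_setU _ _)) le.
    have {le few} : n.+1 < #|R| + 64 * z by rewrite (leq_ltn_trans le) // ltn_add2l.
    by move: #|R| nz => m ->; lia.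
  by apply/forall_inP => l /ABP/and3P[].
apply: (leq_halves (leq_trans (subset_leq_card cov) (leq_card_setU _ _))) => //.
apply: leq_trans card_E3; rewrite leq_mul2l; apply/orP; right.
by rewrite leq_mul2r orbT.
Qed.

End Embedded.

End ThreeConditions.

(** * Random graphs *)

Section Patterns.

Variables (I V L : finType).

Lemma card_pattern (pos : L -> I) (D : {set L}) (A : {set V}) :
  injective pos ->
  #|[set p : {ffun I -> V} | [forall l in D, p (pos l) \in A]]| * #|V| ^ #|D|
    <= #|A| ^ #|D| * #|V| ^ #|I|.
Proof.
move=> pos_inj.
pose S (p : {ffun I -> V}) (l : L) := [set r : {ffun unit -> V} | r tt \in A].
pose pos' (x : L * unit) := pos x.1.
have pos'_inj : injective pos' by move=> [l []] [l' []] /pos_inj /= ->.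
have := @card_blocks I V L unit pos' D #|V| #|A| S pos'_inj.
have -> : [set p : {ffun I -> V} |
    [forall l in D, [ffun k => p (pos' (l, k))] \in S p l]] =
    [set p : {ffun I -> V} | [forall l in D, p (pos l) \in A]].
  apply/setP => p; rewrite !inE; apply: eq_forallb_in => l _.
  by rewrite !inE !ffunE.
apply=> // p l; rewrite card_unit expn1 mulnC leq_mul2l; apply/orP; right.
rewrite -(card_imset (f := fun r : {ffun unit -> V} => r tt)).
  by apply: subset_leq_card; apply/subsetP => _ /imsetP[r + ->]; rewrite inE.
by move=> r r' e1; apply/ffunP => -[].
Qed.

Lemma card_pair_pattern (pos : L * bool -> I) (A : {set V * V}) :
  injective pos ->
  #|[set p : {ffun I -> V} |
      [forall l, (p (pos (l, false)), p (pos (l, true))) \in A]]| * (#|V| ^ 2) ^ #|L|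
    <= #|A| ^ #|L| * #|V| ^ #|I|.
Proof.
move=> pos_inj.
pose S (p : {ffun I -> V}) (l : L) :=
  [set r : {ffun bool -> V} | (r false, r true) \in A].
have := @card_blocks I V L bool pos setT (#|V| ^ 2) #|A| S pos_inj.
have -> : [set p : {ffun I -> V} |
    [forall l in [set: L], [ffun k => p (pos (l, k))] \in S p l]] =
    [set p : {ffun I -> V} |
      [forall l, (p (pos (l, false)), p (pos (l, true))) \in A]].
  apply/setP => p; rewrite !inE; apply: eq_forallb => l.
  by rewrite !inE !ffunE.
rewrite cardsT; apply=> // p l.
rewrite card_bool mulnC leq_mul2l; apply/orP; right.
rewrite -(card_imset (f := fun r : {ffun bool -> V} => (r false, r true))).
  by apply: subset_leq_card; apply/subsetP => _ /imsetP[r + ->]; rewrite inE.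
by move=> r r' [e1 e2]; apply/ffunP => -[].
Qed.

End Patterns.

Section RandomGraph.

Variables (V K : finType) (e0 : {set K}).

Notation fT := {ffun {set V} -> K}.

(** For uniform f this is the random graph of density |e0| / |K|. Colouring sets rather than ordered
    pairs makes it symmetric; the sample space has size [#|K| ^ (2 ^ #|V|)]. *)
Definition color_graph (f : fT) : rel V := fun x y => (x != y) && (f [set x; y] \in e0).

Lemma color_graph_sym f : symmetric (color_graph f).
Proof. by move=> x y; rewrite /color_graph eq_sym setUC. Qed.

Lemma color_graph_irr f x : color_graph f x x = false.
Proof. by rewrite /color_graph eqxx. Qed.

Lemma set2_inj (x y x' y' : V) : x != y' -> [set x; y] = [set x'; y'] ->
  x = x' /\ y = y'.
Proof.
move=> xy' e; have xx' : x = x'.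
  by move/setP/(_ x): e; rewrite !inE eqxx /= (negPf xy') orbF => /esym/eqP.
subst x'; split=> //; move/setP: e => e.
have := e y'; rewrite !inE eqxx orbT eq_sym (negPf xy') /=.
by move=> /eqP.
Qed.

(** First moment: the C(s, 2) edges of an injective copy carry independent colours. *)
Lemma card_cliques (s : nat) :
  #|[set f : fT | [exists g : {ffun 'I_s -> V}, injectiveb g &&
      [forall i, forall j, (i != j) ==> color_graph f (g i) (g j)]]]| * #|K| ^ 'C(s, 2)
  <= #|V| ^ s * (#|e0| ^ 'C(s, 2) * #|K| ^ (2 ^ #|V|)).
Proof.
apply: (@leq_trans (#|[pred g : {ffun 'I_s -> V} | injectiveb g]| *
   (#|e0| ^ 'C(s, 2) * #|K| ^ (2 ^ #|V|)))); last first.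
  by rewrite leq_mul2r (leq_trans (max_card _)) ?orbT // card_ffun card_ord.
apply: card_exists => g /injectiveP g_inj.
pose D := [set A : {set 'I_s} | #|A| == 2].
have := @card_pattern {set V} K {set 'I_s} (fun A => g @: A) D e0 (imset_inj g_inj).
have -> : #|D| = 'C(s, 2) by rewrite card_draws card_ord.
rewrite card_powersets; apply: leq_trans; rewrite leq_mul2r; apply/orP; right.
apply/subset_leq_card/subsetP => f; rewrite !inE => /forallP cl.
apply/forall_inP => A; rewrite inE => /cards2P[i [j [ij ->]]].
by rewrite imsetU1 imset_set1; have /forallP/(_ j)/implyP/(_ ij)/andP[] := cl i.
Qed.

Lemma card_holes (h : nat) :
  #|[set f : fT | [exists g : {ffun bool * 'I_h -> V}, injectiveb g &&
      [forall i, forall j, ~~ color_graph f (g (false, i)) (g (true, j))]]]| * #|K| ^ (h * h)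
  <= #|V| ^ (2 * h) * (#|~: e0| ^ (h * h) * #|K| ^ (2 ^ #|V|)).
Proof.
apply: (@leq_trans (#|[pred g : {ffun bool * 'I_h -> V} | injectiveb g]| *
   (#|~: e0| ^ (h * h) * #|K| ^ (2 ^ #|V|)))); last first.
  rewrite leq_mul2r (leq_trans (max_card _)) ?orbT //.
  by rewrite card_ffun card_prod card_bool card_ord.
apply: card_exists => g /injectiveP g_inj.
have gne i j : g (false, i) != g (true, j) by apply/eqP => /g_inj.
pose pos (ij : 'I_h * 'I_h) := [set g (false, ij.1); g (true, ij.2)].
have pos_inj : injective pos.
  move=> [i j] [i' j'] /(set2_inj (gne _ _)) /=.
  by case=> /g_inj[->] /g_inj[->].
have := @card_pattern {set V} K _ pos setT (~: e0) pos_inj.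
rewrite cardsT card_prod card_ord card_powersets.
apply: leq_trans; rewrite leq_mul2r; apply/orP; right.
apply/subset_leq_card/subsetP => f; rewrite !inE => /forallP cl.
apply/forall_inP => -[i j] _; rewrite inE.
by have /forallP/(_ j) := cl i; rewrite /color_graph gne.
Qed.

(** As the 4q vertices are distinct, the 2q^2 pairs involved are distinct. The q^2 events are thus
    independent, each of probability 1 - (|e0| / |K|)^2. *)
Lemma card_tensor_holes (q : nat) :
  #|[set f : fT | [exists g : {ffun bool * bool * 'I_q -> V}, injectiveb g &&
      [forall i, forall j, ~~ (color_graph f (g (true, false, j)) (g (false, false, i))
        && color_graph f (g (true, true, j)) (g (false, true, i)))]]]|
    * (#|K| ^ 2) ^ (q * q)
  <= #|V| ^ (4 * q) * ((#|K| ^ 2 - #|e0| ^ 2) ^ (q * q) * #|K| ^ (2 ^ #|V|)).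
Proof.
set A := [set f | _]; set cc := _ * #|K| ^ _.
apply: (@leq_trans (#|[pred g : {ffun bool * bool * 'I_q -> V} | injectiveb g]| * cc));
    last first.
  rewrite leq_mul2r (leq_trans (max_card _)) ?orbT //.
  by rewrite card_ffun !card_prod card_bool card_ord.
apply: card_exists => g /injectiveP g_inj.
have gne b b' i j : g (true, b, j) != g (false, b', i) by apply/eqP => /g_inj.
pose pos (y : 'I_q * 'I_q * bool) :=
  [set g (true, y.2, y.1.2); g (false, y.2, y.1.1)].
have pos_inj : injective pos.
  move=> [[i j] b] [[i' j'] b'] /(set2_inj (gne _ _ _ _)) /=.
  by case=> /g_inj[-> ->] /g_inj[->].
pose B := ~: (setX e0 e0).
have := @card_pair_pattern {set V} K _ pos B pos_inj.
have -> : #|B| = #|K| ^ 2 - #|e0| ^ 2.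
  by rewrite cardsCs setCK cardsX -cardsT cardsT card_prod !mulnn.
rewrite card_prod card_ord card_powersets.
apply: leq_trans; rewrite leq_mul2r; apply/orP; right.
apply/subset_leq_card/subsetP => f; rewrite !inE => /forallP cl.
apply/forallP => -[i j]; rewrite !inE.
by have /forallP/(_ j) := cl i; rewrite /color_graph !gne.
Qed.

(** Linearity of expectation over ordered triples; triples with a repeated vertex contribute
    nothing. *)
Lemma sum_triangles :
  (\sum_(f : fT) #|[set t : V * V * V |
      [&& color_graph f t.1.1 t.1.2, color_graph f t.1.2 t.2 & color_graph f t.1.1 t.2]]|) * #|K| ^ 3
  <= #|V| ^ 3 * (#|e0| ^ 3 * #|K| ^ (2 ^ #|V|)).
Proof.
set T := fun f : fT => fun t : V * V * V =>
  [&& color_graph f t.1.1 t.1.2, color_graph f t.1.2 t.2 & color_graph f t.1.1 t.2].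
under eq_bigr => f _ do rewrite -sum1dep_card.
rewrite (exchange_big_dep xpredT) //= big_distrl /=.
apply: (@leq_trans (\sum_(t : V * V * V) (#|e0| ^ 3 * #|K| ^ (2 ^ #|V|)))); last first.
  rewrite sum_nat_const !card_prod.
  by have -> : #|V| * #|V| * #|V| = #|V| ^ 3 by rewrite !expnS expn0 muln1 mulnA.
apply: leq_sum => -[[x y] z'] _ /=; rewrite sum1dep_card.
have [/and3P[xy yz xz]|] := boolP [&& x != y, y != z' & x != z']; last first.
  move=> nd; rewrite (_ : [set _ | _] = set0) ?cards0 //.
  apply/setP => f; rewrite !inE /color_graph; apply/negbTE; apply: contra nd.
  by case/and3P=> /andP[-> _] /andP[-> _] /andP[-> _].
pose pos (i : 'I_3) := if i == 0 :> nat then [set x; y] else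
  if i == 1 :> nat then [set y; z'] else [set x; z'].
have pos_inj : injective pos.
  have n1 : [set x; y] <> [set y; z'].
    by move/setP/(_ x); rewrite !inE eqxx (negPf xy) (negPf xz).
  have n2 : [set x; y] <> [set x; z'].
    by move/setP/(_ y); rewrite !inE eqxx orbT eq_sym (negPf xy) (negPf yz).
  have n3 : [set y; z'] <> [set x; z'].
    by move/setP/(_ y); rewrite !inE eqxx [y == x]eq_sym (negPf xy) (negPf yz).
  move=> [[|[|[|//]]] Hi] [[|[|[|//]]] Hj]; rewrite /pos /= => e;
    try (exact: val_inj); by [case: n1|case: n2|case: n3].
have := @card_pattern {set V} K _ pos setT e0 pos_inj.
rewrite cardsT card_ord card_powersets.
apply: leq_trans; rewrite leq_mul2r; apply/orP; right.
apply/subset_leq_card/subsetP => f; rewrite !inE => /and3P[/andP[_ f1] /andP[_ f2] /andP[_ f3]].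
by apply/forall_inP => -[[|[|[|//]]] Hi] _.
Qed.

End RandomGraph.

Lemma bernoulli (a m : nat) : a ^ m.+1 + m.+1 * a ^ m <= a.+1 ^ m.+1.
Proof.
elim: m => [|m IHm]; first by rewrite !expn1 expn0; lia.
rewrite [leqRHS]expnS; apply: leq_trans (leq_mul (leqnn _) IHm).
rewrite (expnS a m.+1) (expnS a m); move: (a ^ m) => x; nia.
Qed.

Lemma leq_exp_base (a b e : nat) : a <= b -> a ^ e <= b ^ e.
Proof. by case: e => // e ab; rewrite leq_exp2r. Qed.

(** Bernoulli's inequality gives (1 - 1/k)^k <= 1/2, which is raised to the power e. *)
Lemma half_power (k e m : nat) : 0 < k -> k * e <= m -> 2 ^ e * k.-1 ^ m <= k ^ m.
Proof.
case: k => // k _ kem; rewrite -(subnK kem) -[k.+1.-1]/k.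
rewrite [X in _ * X <= _]expnD [leqRHS]expnD mulnCA.
apply: leq_mul; first exact: leq_exp_base.
rewrite !expnM -expnMn; apply: leq_exp_base; apply: leq_trans (bernoulli _ _).
by rewrite mul2n -addnn leq_add2l mulSn expnS leq_addl.
Qed.

Lemma injection_into (T : finType) (X : {set T}) (h : nat) : h <= #|X| ->
  exists2 e : 'I_h -> T, injective e & forall i, e i \in X.
Proof.
move=> hX; exists (fun i => enum_val (widen_ord hX i)); last by move=> i; apply: enum_valP.
by move=> i j /enum_val_inj/(congr1 val) /= /val_inj.
Qed.

(** Deletion method at density 1/k on m vertices: holes of size h occur with probability at most
    1/4, and the mean number of ordered triangles is at most m/8. Some graph thus has no such hole
    and at most m/2 triangles, and the first vertex of each triangle is deleted. Sets of size 2h may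
    overlap but contain disjoint subsets of size h. *)
Lemma triangle_free_graph (m M k h e : nat) :
  0 < k -> 0 < M -> 2 * M <= m -> 8 * m ^ 2 <= k ^ 3 ->
  k * e <= h * h -> 4 * m ^ (2 * h) <= 2 ^ e ->
  exists F : rel 'I_M, [/\ symmetric F,
    forall x y z, ~~ [&& F x y, F y z & F x z] &
    forall X Y : {set 'I_M}, 2 * h <= #|X| -> 2 * h <= #|Y| ->
      exists x y, [/\ x \in X, y \in Y & F x y]].
Proof.
move=> k_gt0 M_gt0 Mm mk keh me.
pose e0 := [set Ordinal k_gt0].
pose fT := {ffun {set 'I_m} -> 'I_k}.
pose tri (f : fT) := [set t : 'I_m * 'I_m * 'I_m |
  [&& color_graph e0 f t.1.1 t.1.2, color_graph e0 f t.1.2 t.2 & color_graph e0 f t.1.1 t.2]].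
pose bad := [set f : fT | [exists g : {ffun bool * 'I_h -> 'I_m}, injectiveb g &&
      [forall i, forall j, ~~ color_graph e0 f (g (false, i)) (g (true, j))]]].
pose Om := #|(fT : finType)|.
have OmE : Om = k ^ (2 ^ m) by rewrite /Om card_ffun card_powersets !card_ord.
have Om_gt0 : 0 < Om by rewrite OmE expn_gt0 k_gt0.
have bad4 : 4 * #|bad| <= Om.
  have := card_holes 'I_m e0 h; rewrite -/bad !card_ord -OmE.
  have -> : #|~: e0| = k.-1 by rewrite cardsCs setCK cards1 card_ord subn1.
  move=> le; have kh_gt0 : 0 < k ^ (h * h) by rewrite expn_gt0 k_gt0.
  rewrite -(leq_pmul2r kh_gt0) -mulnA.
  apply: leq_trans (leq_mul (leqnn 4) le) _; rewrite !mulnA [leqRHS]mulnC leq_mul2r.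
  apply/orP; right; apply: leq_trans (half_power k_gt0 keh).
  by rewrite leq_mul2r me orbT.
have m_gt0 : 0 < m by lia.
have sumtri : 8 * (\sum_(f : fT) #|tri f|) <= m * Om.
  have := sum_triangles 'I_m e0; rewrite !card_ord -OmE cards1 exp1n mul1n => le.
  have m2_gt0 : 0 < m ^ 2 by rewrite expn_gt0 m_gt0.
  rewrite -(leq_pmul2r m2_gt0) [leqRHS]mulnAC -expnS; apply: leq_trans le.
  by rewrite mulnAC mulnC leq_mul2l mk orbT.
have [f fbad ftri] : exists2 f : fT, f \notin bad & 2 * #|tri f| <= m.
  apply/exists_inP; apply: contraTT (sumtri) => /exists_inPn none.
  have : #|~: bad| * m <= 2 * \sum_(f : fT) #|tri f|.
    rewrite -sum_nat_const big_distrr /= [leqRHS](bigID (mem (~: bad))) /=.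
    apply: leq_trans (leq_addr _ _); apply: leq_sum => f.
    by rewrite inE => /none; rewrite -ltnNge => /ltnW.
  have := cardsC bad; rewrite -/Om -ltnNge.
  move: bad4 Om_gt0 m_gt0; move: (\sum_f _) #|bad| #|~: bad| => S b nb; nia.
pose V' := ~: [set t.1.1 | t in tri f].
have V'M : M <= #|V'|.
  have := cardsC [set t.1.1 | t in tri f]; rewrite -/V' card_ord.
  have : #|[set t.1.1 | t in tri f]| <= #|tri f| by apply: leq_imset_card.
  by move: #|[set t.1.1 | t in tri f]| #|V'| #|tri f| ftri => c1 c2 c3; lia.
have [io io_inj ioV] := injection_into V'M.
exists (fun x y => color_graph e0 f (io x) (io y)); split.
- by move=> x y; apply: color_graph_sym.
- move=> x y z; apply/negP => xyz; move: (ioV x); rewrite inE => /negP[].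
  by apply/imsetP; exists (io x, io y, io z) => //; rewrite inE.
move=> X Y hX hY.
have [ex ex_inj exX] := @injection_into _ X h (leq_trans (leq_pmull _ (isT : 0 < 2)) hX).
have hY' : h <= #|Y :\: [set ex i | i : 'I_h]|.
  have := cardsID [set ex i | i : 'I_h] Y.
  have := leq_trans (subset_leq_card (subsetIr Y [set ex i | i : 'I_h])) (leq_imset_card _ _).
  rewrite card_ord; move: #|Y :&: _| #|Y :\: _| => c1 c2; move: #|Y| hY => c3; lia.
have [ey ey_inj eyY] := injection_into hY'.
pose g := [ffun y : bool * 'I_h => io (if y.1 then ey y.2 else ex y.2)].
have exy i j : ex i <> ey j.
  by move=> e1; have := eyY j; rewrite inE -e1 imset_f.
have g_inj : injectiveb g.
  apply/injectiveP => -[b1 i] [b2 j]; rewrite !ffunE => /io_inj.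
  by case: b1 b2 => -[] /=; [move/ey_inj ->|move/esym/exy|move/exy|move/ex_inj ->].
move: fbad; rewrite inE => /existsPn/(_ g); rewrite g_inj /=.
rewrite negb_forall => /existsP[i]; rewrite negb_forall => /existsP[j].
rewrite negbK !ffunE /= => Fij; exists (ex i), (ey j); split=> //.
by have := eyY j; rewrite inE => /andP[].
Qed.

(** * Hypergraphs defined by conditions on triples *)

Lemma triples_card (N : nat) (P : 'I_N -> 'I_N -> 'I_N -> bool) e :
  e \in [set e : {set 'I_N} | (#|e| == 3) &&
    [exists u, exists v, exists w, (e == [set u; v; w]) && P u v w]] -> #|e| = 3.
Proof. by rewrite inE => /andP[/eqP]. Qed.

Definition triples (N : nat) (P : 'I_N -> 'I_N -> 'I_N -> bool) : graph3 'I_N :=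
  Hypergraph (@triples_card N P).

Lemma cards3 (T : finType) (x y z : T) :
  x != y -> y != z -> x != z -> #|[set x; y; z]| = 3.
Proof.
move=> xy yz xz; rewrite setUC cardsU1 cards2 xy !inE.
by rewrite [z == x]eq_sym [z == y]eq_sym (negPf xz) (negPf yz).
Qed.

Lemma set3_perm (T : finType) (a b c u v w : T) :
  a != b -> b != c -> a != c -> [set a; b; c] = [set u; v; w] ->
  [\/ (u, v, w) = (a, b, c), (u, v, w) = (b, a, c) |
   [\/ (u, v, w) = (a, c, b), (u, v, w) = (c, a, b) |
    (u, v, w) = (b, c, a) \/ (u, v, w) = (c, b, a)]].
Proof.
move=> ab bc ac e.
have c3 : #|[set u; v; w]| = 3 by rewrite -e cards3.
have uv : u != v.
  by apply: contra_eqN c3 => /eqP ->; rewrite setUid cards2; case: (v != w).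
have vw : v != w.
  by apply: contra_eqN c3 => /eqP ->; rewrite -setUA setUid cards2; case: (u != w).
have uw : u != w.
  by apply: contra_eqN c3 => /eqP ->; rewrite setUAC setUid cards2; case: (w != v).
have hu : u \in [set a; b; c] by rewrite e !inE eqxx.
have hv : v \in [set a; b; c] by rewrite e !inE eqxx orbT.
have hw : w \in [set a; b; c] by rewrite e !inE eqxx orbT.
move: hu hv hw uv vw uw; rewrite !inE -!orbA.
case/or3P=> /eqP ->; case/or3P=> /eqP ->; case/or3P=> /eqP ->; rewrite ?eqxx // => _ _ _.
- by constructor 1.
- by constructor 3; constructor 1.
- by constructor 2.
- by constructor 3; constructor 3; left.
- by constructor 3; constructor 2.
- by constructor 3; constructor 3; right.
Qed.

Lemma tripartite_in_complement (n N : nat) (P : 'I_N -> 'I_N -> 'I_N -> bool) :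
  has_copy (tripartite n) (complement (triples P)) ->
  exists2 f : 'I_3 * 'I_n -> 'I_N, injective f &
    forall x y z, x.1 != y.1 -> y.1 != z.1 -> x.1 != z.1 -> ~~ P (f x) (f y) (f z).
Proof.
case=> f f_inj copy; exists f => // x y z xy yz xz.
have nx : x != y by apply: contra xy => /eqP ->.
have ny : y != z by apply: contra yz => /eqP ->.
have nz : x != z by apply: contra xz => /eqP ->.
have /copy : [set x; y; z] \in edges (tripartite n).
  rewrite inE cards3 // eqxx /=; apply/forallP => i.
  have : i \in [set x.1; y.1; z.1].
    suff -> : [set x.1; y.1; z.1] = setT by rewrite inE.
    by apply/eqP; rewrite eqEcard subsetT cardsT card_ord cards3.
  rewrite !inE -orbA => iP.
  suff [t ->] : exists t, [set s in [set x; y; z] | s.1 == i] = [set t] by rewrite cards1.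
  case/or3P: iP => /eqP ->; [exists x|exists y|exists z]; apply/setP => s; rewrite !inE -orbA;
    apply/andP/eqP => [[/or3P[] /eqP -> //]|->];
    rewrite ?eqxx ?orbT // ?(negPf xy) ?(negPf yz) ?(negPf xz) //;
    by rewrite eq_sym ?(negPf xy) ?(negPf yz) ?(negPf xz).
have fx : f x != f y by rewrite (inj_eq f_inj).
have fy : f y != f z by rewrite (inj_eq f_inj).
have fz : f x != f z by rewrite (inj_eq f_inj).
have -> : f @: [set x; y; z] = [set f x; f y; f z].
  by rewrite imsetU imsetU1 !imset_set1.
rewrite inE cards3 // eqxx /= inE cards3 // eqxx /= negb_exists => /forallP/(_ (f x)).
rewrite negb_exists => /forallP/(_ (f y)); rewrite negb_exists => /forallP/(_ (f z)).
by rewrite eqxx.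
Qed.

Lemma link_in_triples (s N : nat) (P : 'I_N -> 'I_N -> 'I_N -> bool) :
  has_copy (link (K s)) (triples P) ->
  exists (v : 'I_N) (x : 'I_s -> 'I_N), [/\ injective x, forall i, x i != v &
    forall i j, i != j -> [|| P v (x i) (x j), P v (x j) (x i), P (x i) v (x j),
      P (x j) v (x i), P (x i) (x j) v | P (x j) (x i) v]].
Proof.
case=> f f_inj copy; exists (f None), (fun i => f (Some i)).
have xv i : f (Some i) != f None by rewrite (inj_eq f_inj).
split=> // [i j /f_inj[] //|i j ij].
have /copy : None |: [set Some y | y in [set i; j]] \in edges (link (K s)).
  by apply/imsetP; exists [set i; j] => //; rewrite inE cards2 ij.
rewrite imsetU1 imset_set1 imsetU1 imsetU1 imset_set1 setUA inE.
case/andP=> _ /existsP[u /existsP[v /existsP[w /andP[/eqP e Puvw]]]].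
have vi : f None != f (Some i) by rewrite eq_sym.
have vj : f None != f (Some j) by rewrite eq_sym.
have nij : f (Some i) != f (Some j) by rewrite (inj_eq f_inj); apply: contra ij => /eqP[->].
have := set3_perm vi nij vj e.
by case=> [[? ? ?]|[? ? ?]|[[? ? ?]|[? ? ?]|[[? ? ?]|[? ? ?]]]]; subst; rewrite Puvw ?orbT.
Qed.

(** * The lower bound for bounded s *)

Lemma not_all_bad (I V : finType) (B : {set {ffun I -> V}}) (c Y : nat) :
  0 < #|V| -> #|B| * Y <= c * #|V| ^ #|I| -> c < Y -> exists x, x \notin B.
Proof.
move=> V_gt0 BY cY; apply/existsP; rewrite -negb_forall; apply/negP => /forallP allB.
have cB : #|B| = #|V| ^ #|I|.
  by rewrite -card_ffun -cardsT; congr #|pred_of_set _|; apply/setP => x; rewrite inE allB.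
have P0 : 0 < #|V| ^ #|I| by rewrite expn_gt0 V_gt0.
by move: BY; rewrite cB mulnC leq_pmul2r // leqNgt cY.
Qed.

(** Union bound over the at most N^(3(n+1)) placements of the three blocks. The link of v maps
    homomorphically to F by sending w to the colour of (v, w); as F is triangle-free, the link
    contains no K_s with s >= 3. *)
Lemma three_conditions_lower (V : finType) (F : rel V) (h k N s n z w t X3 X6 Y : nat) :
  symmetric F -> (forall x y z, ~~ [&& F x y, F y z & F x z]) -> 2 < s ->
  0 < h -> (forall X Y : {set V}, h <= #|X| -> h <= #|Y| ->
    exists x y, [/\ x \in X, y \in Y & F x y]) ->
  0 < #|V| -> 3 * h * k <= #|V| ->
  n.+1 = 128 * z -> z = 32 * (w * #|V| ^ 2) -> n.+1 <= t * w -> 0 < w ->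
  (2 ^ n.+1 + (n.+1 * 2 ^ #|V|) ^ t * 2 ^ n.+1) * X3 <= k ^ (64 * z) ->
  2 ^ (#|V| ^ 2) * 2 ^ n.+1 * X6 <= k ^ (2 * z) ->
  4 * 2 ^ n.+1 * Y <= X3 ^ (64 * z) ->
  2 ^ n.+1 * (4 ^ n.+1) ^ n.+1 * (4 * 2 ^ (n.+1 ^ 2)) * Y <= k ^ (128 * z ^ 2) ->
  2 ^ n.+1 * (4 ^ n.+1) ^ n.+1 * (n.+1 * (4 * 2 ^ n.+1)) * Y <= X6 ^ z ->
  ramsey_prop (link (K s)) (tripartite n.+1) N -> Y <= N ^ (3 * n.+1).
Proof.
move=> Fsym Ftri s3 h_gt0 hole V_gt0 hk nz zw tw w_gt0 hX3 hX6 hY3 hY5 hY6 ram.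
rewrite leqNgt; apply/negP => NY.
pose i0 : 'I_3 := inord 0; pose i1 : 'I_3 := inord 1; pose i2 : 'I_3 := inord 2.
have i01 : i0 != i1 by rewrite -val_eqE /= !inordK.
have i12 : i1 != i2 by rewrite -val_eqE /= !inordK.
have i02 : i0 != i2 by rewrite -val_eqE /= !inordK.
pose bad (f : {ffun 'I_3 * 'I_n.+1 -> 'I_N}) := [pred x : {ffun 'I_N * 'I_N -> V} |
  [forall i, forall j, forall l, ~~ three_conditions F x (f (i0, i)) (f (i1, j)) (f (i2, l))]].
have cbad (f : {ffun 'I_3 * 'I_n.+1 -> 'I_N}) : injectiveb f ->
    #|[set x | bad f x]| * Y <= #|V| ^ (N * N).
  move=> /injectiveP f_inj.
  apply: (card_no_triple (a := fun i => f (i0, i)) (b := fun i => f (i1, i))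
    (c := fun i => f (i2, i)) h_gt0 hole V_gt0 hk _ _ _ _ _ _ nz zw tw w_gt0 hX3 hX6) => //.
  - by move=> i j /f_inj[].
  - by move=> i j /f_inj[].
  - by move=> i j /f_inj[].
  - by move=> i j /f_inj[e _]; move: i01; rewrite e eqxx.
  - by move=> i j /f_inj[e _]; move: i02; rewrite e eqxx.
  - by move=> i j /f_inj[e _]; move: i12; rewrite e eqxx.
have {cbad} := card_exists cbad.
set B := [set x | _] => cB.
have [|//|x] := @not_all_bad _ V B (N ^ (3 * n.+1)) Y V_gt0.
  rewrite card_prod !card_ord; apply: leq_trans cB _; rewrite leq_mul2r; apply/orP; right.
  by apply: leq_trans (max_card _) _; rewrite card_ffun card_prod !card_ord.
rewrite inE => /existsPn good.
case: (ram (triples (three_conditions F x))).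
  case/link_in_triples=> v [y [y_inj _ yP]].
  have Fy i j : i != j -> F (x (v, y i)) (x (v, y j)).
    move=> /yP; rewrite /three_conditions.
    by case/orP=> [|/orP[|/orP[|/orP[|/orP[]]]]] /and3P[c1 c2 c3];
      first [exact: c1|exact: c2|exact: c3|by rewrite Fsym].
  pose y0 : 'I_s := Ordinal (ltnW (ltnW s3)).
  pose y1 : 'I_s := Ordinal (ltnW s3). pose y2 : 'I_s := Ordinal s3.
  by have /negP[] := Ftri (x (v, y y0)) (x (v, y y1)) (x (v, y y2)); rewrite !Fy.
case/tripartite_in_complement=> f f_inj fP.
have /negP[] := good [ffun y => f y]; apply/andP; split.
  by apply/injectiveP => y y'; rewrite !ffunE => /f_inj.
apply/forallP => i; apply/forallP => j; apply/forallP => l; rewrite !ffunE; exact: fP.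
Qed.

Lemma linear_lt_exp2 (x : nat) : 7 < x -> 6 * x + 20 <= 2 ^ x.
Proof.
elim: x => // x IHx; rewrite ltnS leq_eqVlt => /predU1P[<- //|/IHx].
by rewrite expnS; lia.
Qed.

(** F has 2^(24p - 1) vertices, a small power of the block size nu = 2^L = 128z. The condition
    [24 * p <= om] gives 2|V| <= w, so guessing sets of colours is cheap. The factor in p gives 4p
    z^2 = 2r nu^2: half of this exponent is the final gain, the other half pays for the guesses. *)
Lemma small_clique_block_lower (r om s N : nat) (p := 64 * (128 * r)) (L := 48 * p + 10 + om) :
  10 <= r -> 24 * p <= om -> 2 < s ->
  ramsey_prop (link (K s)) (tripartite (2 ^ L)) N -> 2 ^ (r * 2 ^ L) <= N ^ 3.
Proof.
have aux3 (a b c d : nat) : 2 + a + b <= c * d -> 4 * 2 ^ a * 2 ^ b <= (2 ^ c) ^ d.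
  by move=> le; rewrite -[4]/(2 ^ 2) -!expnD -expnM leq_pexp2l.
have aux5 (a b c d e f g : nat) : a + 2 * (b * c) + (2 + d) + e <= f * g ->
    2 ^ a * (4 ^ b) ^ c * (4 * 2 ^ d) * 2 ^ e <= (2 ^ f) ^ g.
  by move=> le; rewrite -[4]/(2 ^ 2) -!expnM -!expnD leq_pexp2l.
have aux6 (a b c l d e f g : nat) : a + 2 * (b * c) + (l + (2 + d)) + e <= f * g ->
    2 ^ a * (4 ^ b) ^ c * (2 ^ l * (4 * 2 ^ d)) * 2 ^ e <= (2 ^ f) ^ g.
  by move=> le; rewrite -[4]/(2 ^ 2) -!expnM -!expnD leq_pexp2l.
move=> r10 pom s3.
have pE : p = 64 * (128 * r) by [].
clearbody p.
have p40 : 40 <= p by lia.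
pose mu := (24 * p).-1.
have mu1 : mu.+1 = 24 * p by rewrite /mu prednK //; lia.
(* The deletion starts from m = 2M = 2^(24p) vertices. Then kc^3 = 8m^2 exactly, and h^2 >= kc (48p
   h + 2), where 2^(48p h + 2) = 4 m^(2h). *)
pose M := 2 ^ mu; pose kc := 2 ^ (16 * p + 1); pose h := kc * (48 * p + 2).
pose z := 2 ^ (48 * p + 3 + om); pose w := 2 ^ om; pose t := 2 ^ (48 * p + 10).
pose k := 2 ^ (4 * p); pose nu := 2 ^ L.
have pos2 e : 0 < 2 ^ e by rewrite expn_gt0.
have h_gt0 : 0 < h by rewrite /h muln_gt0 pos2 /=; lia.
have [|||||| F [Fsym Ftri Fhole]] := @triangle_free_graph (2 ^ (24 * p)) M kc h (48 * p * h + 2).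
- exact: pos2.
- exact: pos2.
- by rewrite -mu1 expnS.
- by rewrite -[8]/(2 ^ 3) -!expnM -expnD leq_pexp2l //; lia.
- rewrite {2}/h -[kc * _ * h]mulnA leq_mul2l; apply/orP; right; rewrite mulnDl leq_add2l.
  by rewrite leq_pmulr.
- by rewrite -[4]/(2 ^ 2) -expnM -expnD leq_pexp2l //; lia.
have nuE : nu.-1.+1 = nu by rewrite prednK ?pos2.
rewrite -/nu -nuE => ram.
have nuz : nu = 128 * z.
  by rewrite -[128]/(2 ^ 7) -expnD; congr (2 ^ _); rewrite /L; lia.
have z_gt0 : 0 < z := pos2 _.
have pz : 40 * z <= p * z by rewrite leq_mul2r p40 orbT.
have Lnu : L <= nu by rewrite ltnW // ltn_expl.
have zw : z = 32 * (w * M ^ 2).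
  by rewrite -[32]/(2 ^ 5) -expnM -!expnD; congr (2 ^ _); lia.
have nutw : nu = t * w by rewrite -expnD.
have LMw : L + M <= w.
  have := @linear_lt_exp2 om; have : M * 2 <= w.
    by rewrite -expnSr mu1 leq_pexp2l.
  rewrite -/w /L; lia.
pose q := r * (z * z).
have zq : 10 * z <= q by rewrite /q leq_mul // leq_pmulr.
have pzz : p * (z * z) = 64 * (128 * q) by rewrite pE /q !mulnA.
have rnu : r * nu ^ 2 = 128 * (128 * q) by rewrite nuz /q; move: (r) (z) => *; ring.
have nunu : 10 * nu ^ 2 <= 128 * (128 * q).
  by rewrite -rnu leq_mul2r r10 orbT.
have e3 : 2 + nu + r * nu ^ 2 <= p * nu * (64 * z).
  have -> : p * nu * (64 * z) = 64 * (128 * (p * (z * z))) by rewrite nuz; move: (p) (z) => *; ring.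
  rewrite rnu pzz nuz; lia.
have e5 : nu + 2 * (nu * nu) + (2 + nu ^ 2) + r * nu ^ 2 <= 4 * p * (128 * z ^ 2).
  have -> : 4 * p * (128 * z ^ 2) = 512 * (p * (z * z)) by move: (p) (z) => *; ring.
  rewrite rnu pzz mulnn; move: (nu ^ 2) nunu => y; rewrite nuz; lia.
have e6 : nu + 2 * (nu * nu) + (L + (2 + nu)) + r * nu ^ 2 <= 4 * p * z * z.
  have -> : 4 * p * z * z = 4 * (p * (z * z)) by move: (p) (z) => *; ring.
  rewrite rnu pzz mulnn; move: (nu ^ 2) nunu => y; lia.
(* [X3] and [X6] take half of the exponents of k^(64z) and k^(2z); the other half absorbs the
   numbers of choices. *)
have : 2 ^ (r * nu ^ 2) <= N ^ (3 * nu.-1.+1).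
  apply: (@three_conditions_lower 'I_M F (2 * h) k N s nu.-1 z w t
    (2 ^ (p * nu)) (2 ^ (4 * p * z)) (2 ^ (r * nu ^ 2)) Fsym Ftri s3) => //;
    rewrite ?nuE ?card_ord //.
  - by rewrite muln_gt0.
  - exact: pos2.
  - rewrite /h /kc /M /k.
    have -> : 3 * (2 * (2 ^ (16 * p + 1) * (48 * p + 2))) * 2 ^ (4 * p) =
      6 * (48 * p + 2) * 2 ^ (20 * p + 1).
      have -> : 2 ^ (20 * p + 1) = 2 ^ (16 * p + 1) * 2 ^ (4 * p).
        by rewrite -expnD; congr (2 ^ _); lia.
      by move: (p) (2 ^ (16 * p + 1)) (2 ^ (4 * p)) => *; ring.
    apply: (@leq_trans (2 ^ 9 * 2 ^ p * 2 ^ (20 * p + 1))).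
      rewrite leq_mul2r; apply/orP; right.
      have := @linear_lt_exp2 p; rewrite -[2 ^ 9]/(64 * 8); move: (2 ^ p) => y; lia.
    by rewrite -!expnD leq_pexp2l //; lia.
  - by rewrite nutw.
  - exact: pos2.
  - have -> : (nu * 2 ^ M) ^ t = 2 ^ ((L + M) * t) by rewrite -expnD -expnM.
    apply: (@leq_trans (2 ^ (nu + nu).+1 * 2 ^ (p * nu))).
      rewrite leq_mul2r; apply/orP; right; rewrite expnS mul2n -addnn.
      apply: leq_add; first by rewrite leq_pexp2l // leq_addl.
      by rewrite -expnD leq_pexp2l // leq_add2r nutw mulnC leq_mul2l LMw orbT.
    rewrite -expnD -expnM leq_pexp2l // nuz.
    have -> : p * (128 * z) = 128 * (p * z) by move: (p) (z) => *; ring.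
    have -> : 4 * p * (64 * z) = 256 * (p * z) by move: (p) (z) => *; ring.
    lia.
  - rewrite -[k ^ _]expnM -!expnD leq_pexp2l // nuz.
    have -> : 4 * p * (2 * z) = 8 * (p * z) by move: (p) (z) => *; ring.
    have -> : 4 * p * z = 4 * (p * z) by move: (p) (z) => *; ring.
    have : M ^ 2 <= z by rewrite zw mulnA leq_pmull // muln_gt0 pos2.
    lia.
  - exact: aux3 e3.
  - exact: aux5 e5.
  exact: aux6 e6.
rewrite nuE => le; rewrite -(@leq_exp2r _ _ nu) ?pos2 //.
by rewrite -[(2 ^ _) ^ _]expnM -[(N ^ _) ^ _]expnM -mulnA mulnn.
Qed.

Lemma has_copy_trans (k : nat) (U V W : finType) (A : hypergraph k U)
    (B : hypergraph k V) (C : hypergraph k W) :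
  has_copy A B -> has_copy B C -> has_copy A C.
Proof.
case=> f f_inj fP [g g_inj gP]; exists (g \o f); first exact: inj_comp.
by move=> e /fP/gP; rewrite imset_comp.
Qed.

Lemma tripartite_mono (m n : nat) : m <= n -> has_copy (tripartite m) (tripartite n).
Proof.
move=> mn; pose g (x : 'I_3 * 'I_m) := (x.1, widen_ord mn x.2).
have g_inj : injective g.
  by move=> [i j] [i' j'] [-> e]; congr (_, _); apply: val_inj.
exists g => // e; rewrite !inE card_imset // => /andP[-> /forallP e1] /=.
apply/forallP => i.
have -> : [set x in g @: e | x.1 == i] = g @: [set x in e | x.1 == i].
  apply/setP => y; rewrite inE; apply/andP/imsetP.
    by case=> /imsetP[x xe ->] xi; exists x => //; rewrite inE xe.
  by case=> x; rewrite inE => /andP[xe xi] ->; rewrite imset_f.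
by rewrite card_imset.
Qed.

Lemma ramsey_prop_mono (U : finType) (H : graph3 U) (m n N : nat) : m <= n ->
  ramsey_prop H (tripartite n) N -> ramsey_prop H (tripartite m) N.
Proof.
move=> mn ram G; case: (ram G) => [|cp]; [by left|right].
exact: has_copy_trans (tripartite_mono mn) cp.
Qed.

(** For bounded s the binomial coefficient is at most a fixed power of n, so n^n is the right
    target. Blocks are shortened to 2^Lg with Lg = log2 n rounded down, and r is a constant fraction
    of Lg. The constant [c1] ensures 72p + 10 <= Lg, which leaves om >= 24p. *)
Lemma small_clique_lower : exists n0 D, forall s n N, 2 < s -> n0 <= n ->
  ramsey_prop (link (K s)) (tripartite n) N -> n ^ n <= N ^ D.
Proof.
have [c1 c1P] : exists c1, forall r, c1 * r = 72 * (64 * (128 * r)) + 10 * r.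
  by exists (72 * (64 * 128) + 10) => r; rewrite mulnDl !mulnA.
have c1_gt0 : 0 < c1 by have := c1P 1; rewrite muln1; lia.
exists (2 ^ (10 * c1)), (12 * c1) => s n N s3 n0n ram.
pose Lg := trunc_log 2 n; pose r := Lg %/ c1.
have n_gt0 : 0 < n by apply: leq_trans n0n; rewrite expn_gt0.
have Lgn : 2 ^ Lg <= n by rewrite trunc_logP.
have nLg : n < 2 ^ Lg.+1 by rewrite trunc_log_ltn.
have r10 : 10 <= r.
  rewrite leq_divRL // -ltnS -(@ltn_exp2l 2) //; exact: leq_ltn_trans n0n nLg.
have rLg : 72 * (64 * (128 * r)) + 10 * r <= Lg by rewrite -c1P mulnC leq_divM.
have Lgr : Lg.+1 <= 2 * (c1 * r).
  have : Lg < r.+1 * c1 by rewrite -ltn_divLR.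
  rewrite mulSn [r * _]mulnC => Lg1; apply: leq_trans Lg1 _.
  by rewrite mul2n -addnn leq_add2r leq_pmulr // (leq_trans _ r10).
pose om := Lg - 48 * (64 * (128 * r)) - 10.
have omE : 48 * (64 * (128 * r)) + 10 + om = Lg by rewrite /om; lia.
have := @small_clique_block_lower r om s N r10 _ s3.
rewrite omE => /(_ _ (ramsey_prop_mono Lgn ram)) le.
have {}le : 2 ^ (r * 2 ^ Lg) <= N ^ 3 by apply: le; rewrite /om; lia.
apply: (@leq_trans ((2 ^ Lg.+1) ^ n)); first by rewrite leq_exp_base // ltnW.
apply: (@leq_trans ((2 ^ (2 * (c1 * r))) ^ (2 * 2 ^ Lg))).
  apply: (@leq_trans ((2 ^ (2 * (c1 * r))) ^ n)).
    by rewrite leq_exp_base // leq_pexp2l.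
  by rewrite leq_pexp2l ?expn_gt0 // -expnS ltnW.
have -> : 12 * c1 = 3 * (4 * c1) by lia.
rewrite [N ^ _]expnM; apply: leq_trans (leq_exp_base _ le).
rewrite -!expnM leq_pexp2l //; move: (2 ^ Lg) => y.
by rewrite leq_eqVlt; apply/orP; left; apply/eqP; move: (r) => r'; ring.
Qed.

(** * Conditions at the two extreme vertices *)

Section TwoConditions.

Variables (V : finType) (F : rel V) (k q : nat).

Definition uncovered (y : 'I_q -> V * V) :=
  [set v : V * V | [forall i, ~~ (F v.1 (y i).1 && F v.2 (y i).2)]].

Hypothesis V_gt0 : 0 < #|V|.
Hypothesis cover : forall Q : {set V * V}, #|V| ^ 2 < #|Q| * k ->
  exists2 y : {ffun 'I_q -> V * V}, forall i, y i \in Q &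
    #|uncovered y| * k <= #|V| ^ 2.

(** Here r gives the colours from some a and some c towards the vertices b, and y is a candidate for
    the colours of (a, c) and (c, a). *)
Definition missed_pairs n (r : {ffun bool * 'I_n -> V}) :=
  [set y : V * V | [forall j, ~~ (F (r (false, j)) y.1 && F (r (true, j)) y.2)]].

(** Many missed pairs contain q pairs whose uncovered set is small, and that set confines all n
    colour pairs of r. Guessing the q pairs costs |V|^(2q); guessing a set of pairs, as in
    [card_many_sparse_pairs], would cost 2^(|V|^2), too much for the exponentially large V used
    here. *)
Lemma card_many_missed_pairs (n : nat) :
  #|[set r : {ffun bool * 'I_n -> V} | #|V| ^ 2 < #|missed_pairs r| * k]| * k ^ n
  <= (#|V| ^ 2) ^ q * (2 ^ n * #|V| ^ (2 * n)).
Proof.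
pose S (y : {ffun 'I_q -> V * V}) (r : {ffun bool * 'I_n -> V}) (j : 'I_n) :=
  if #|uncovered y| * k <= #|V| ^ 2 then uncovered y else set0.
pose E y := [pred r : {ffun bool * 'I_n -> V} |
  n <= #|[set j | (r (false, j), r (true, j)) \in S y r j]|].
have cE y : true -> #|[set r | E y r]| * k ^ n <= 2 ^ n * #|V| ^ (2 * n).
  move=> _.
  have := @card_many_pairs _ V 'I_n (fun x => (x.2, x.1)) n k (S y).
  rewrite card_ord card_prod card_bool card_ord.
  apply=> [[x b] [x' b'] [-> ->]//|p p' _ c //|r c].
  by rewrite /S; case: ifP => // _; rewrite cards0.
have {cE} := card_exists cE.
have -> : #|(fun _ : {ffun 'I_q -> V * V} => true)| = (#|V| ^ 2) ^ q.
  by rewrite (eq_card (B := predT)) // card_ffun card_prod card_ord mulnn.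
apply: leq_trans; rewrite leq_mul2r; apply/orP; right.
apply/subset_leq_card/subsetP => r; rewrite !inE => /cover[y yQ yk].
apply/existsP; exists y => /=.
rewrite (_ : [set j | _] = setT) ?cardsT ?card_ord //.
apply/setP => j; rewrite !inE /S yk inE; apply/forallP => i.
by have := yQ i; rewrite inE => /forallP/(_ j).
Qed.

Section Embedded.

Variables (N n u X Y : nat) (a b c : 'I_n.+1 -> 'I_N).
Hypothesis a_inj : injective a.
Hypothesis b_inj : injective b.
Hypothesis c_inj : injective c.
Hypothesis ab : forall i j, a i <> b j.
Hypothesis ac : forall i j, a i <> c j.
Hypothesis bc : forall i j, b i <> c j.
Hypothesis nu : n.+1 = 2 * u.
Hypothesis X_small : (#|V| ^ 2) ^ q * 2 ^ n.+1 * X <= k ^ n.+1.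
Hypothesis Y1 : 2 ^ (n.+1 ^ 2) * (2 * Y) <= k ^ (2 * u ^ 2).
Hypothesis Y2 : n.+1 * 2 ^ n.+1 * (2 * Y) <= X ^ u.

Notation chiT := {ffun 'I_N * 'I_N -> V}.

Definition two_conditions (x : chiT) (u v w : 'I_N) :=
  F (x (u, v)) (x (u, w)) && F (x (w, v)) (x (w, u)).

Let rr (x : chiT) (il : 'I_n.+1 * 'I_n.+1) := [ffun y : bool * 'I_n.+1 =>
  x (if y.1 then c il.2 else a il.1, b y.2)].

Let S1 x il := if #|missed_pairs (rr x il)| * k <= #|V| ^ 2
  then missed_pairs (rr x il) else set0.

Let pos1 (y : 'I_n.+1 * 'I_n.+1 * bool) :=
  if y.2 then (c y.1.2, a y.1.1) else (a y.1.1, c y.1.2).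

Let E1 := [set x : chiT | 2 * u ^ 2 <=
  #|[set il | (x (pos1 (il, false)), x (pos1 (il, true))) \in S1 x il]|].

Let card_E1 : #|E1| * (2 * Y) <= #|V| ^ (N * N).
Proof.
have pos1_inj : injective pos1.
  move=> [[i j] []] [[i' j'] []] [] /=.
  - by move=> /c_inj -> /a_inj ->.
  - by move/esym/ac.
  - by move/ac.
  - by move=> /a_inj -> /c_inj ->.
have := @card_many_pairs _ V _ pos1 (2 * u ^ 2) k S1 pos1_inj.
rewrite !card_prod !card_ord mulnn -/E1 => cE1.
have {}cE1 : #|E1| * k ^ (2 * u ^ 2) <= 2 ^ (n.+1 ^ 2) * #|V| ^ (N * N).
  apply: cE1 => [p p' pp' il|p il]; last first.
    by rewrite /S1; case: ifP => // _; rewrite cards0.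
  suff rpp : rr p il = rr p' il by rewrite /S1 rpp.
  apply/ffunP => -[e l]; rewrite !ffunE; apply: pp'; apply/codomP => -[[il' []]] [] _ /=.
    by move/esym/ab.
  exact: bc.
by apply: (leq_trade _ cE1); rewrite ?expn_gt0.
Qed.

Let S2 (x : chiT) (i : 'I_n.+1) :=
  [set r : {ffun bool * 'I_n.+1 -> V} | #|V| ^ 2 < #|missed_pairs r| * k].

Let pos2 (j : 'I_n.+1) (y : 'I_n.+1 * (bool * 'I_n.+1)) :=
  (if y.2.1 then c (y.1 + j)%R else a y.1, b y.2.2).

Let E2 j := [pred x : chiT | u <= #|[set i | [ffun y => x (pos2 j (i, y))] \in S2 x i]|].

Let card_E2 : #|[set x | [exists j, true && E2 j x]]| * (2 * Y) <= #|V| ^ (N * N).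
Proof.
have e : #|(fun _ : 'I_n.+1 => true)| = n.+1.
  by rewrite (eq_card (B := predT)) // card_ord.
suff cE2 : #|[set x | [exists j, true && E2 j x]]| * X ^ u
    <= n.+1 * (2 ^ n.+1 * #|V| ^ (N * N)).
  rewrite mulnA in cE2; apply: (leq_trade _ cE2) => //.
  by rewrite muln_gt0 expn_gt0.
rewrite -[X in _ <= X * _]e; apply: card_exists => j _.
have pos2_inj : injective (pos2 j).
  move=> [i [[] l]] [i' [[] l']] [] /=.
  - by move=> /c_inj/GRing.addIr -> /b_inj ->.
  - by move/esym/ac.
  - by move/ac.
  - by move=> /a_inj -> /b_inj ->.
have := @card_many_blocks _ V _ _ (pos2 j) u X S2 pos2_inj.
rewrite !card_prod !card_ord card_bool; apply=> // x i.
apply: (@leq_trade _ _ _ _ (k ^ n.+1) _ _ X_small); last first.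
  rewrite -mulnA; exact: card_many_missed_pairs.
by rewrite !muln_gt0 !expn_gt0 V_gt0.
Qed.

(** When no triple works, the colours of (a_i, c_l) and (c_l, a_i) form a missed pair for all i, l.
    If at least half of the 4u^2 index pairs have many missed pairs ([thick]), some shift carries u
    of them ([E2]); otherwise 2u^2 of them hit a small set ([E1]). *)
Lemma card_no_ordered_triple :
  #|[set x : chiT | [forall i, forall j, forall l,
      ~~ two_conditions x (a i) (b j) (c l)]]| * Y <= #|V| ^ (N * N).
Proof.
set E := [set x | _].
suff cov : E \subset E1 :|: [set x | [exists j, true && E2 j x]].
  exact: leq_halves (leq_trans (subset_leq_card cov) (leq_card_setU _ _)) card_E1 card_E2.
apply/subsetP => x; rewrite inE => /forallP bad; rewrite in_setU.
pose thick := [set il | #|V| ^ 2 < #|missed_pairs (rr x il)| * k].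
have [many|few] := leqP (u * n.+1) #|thick|.
  apply/orP; right; rewrite inE; have [j jP] := exists_shift many.
  apply/existsP; exists j => /=; apply: leq_trans jP _.
  apply/subset_leq_card/subsetP => i; rewrite !inE.
  suff -> : rr x (i, (i + j)%R) = [ffun y => x (pos2 j (i, y))] by [].
  by apply/ffunP => -[e l]; rewrite !ffunE.
apply/orP; left; rewrite inE.
have : ~: thick \subset [set il | (x (pos1 (il, false)), x (pos1 (il, true))) \in S1 x il].
  apply/subsetP => -[i l]; rewrite !inE -leqNgt /S1 => ->; rewrite inE.
  apply/forallP => j; rewrite !ffunE /=.
  by have /forallP/(_ j)/forallP/(_ l) := bad i.
move/subset_leq_card; apply: leq_trans.
have := cardsC thick; rewrite card_prod card_ord => tc.
rewrite -(leq_add2l #|thick|) tc; apply: (@leq_trans (u * n.+1 + 2 * u ^ 2)).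
  by rewrite leq_add2r ltnW.
rewrite nu -mulnn.
by rewrite leq_eqVlt; apply/orP; left; apply/eqP; move: (u) => v; ring.
Qed.

End Embedded.

End TwoConditions.

Section Ordering.

Variables (n N m : nat) (f : 'I_3 * 'I_n -> 'I_N).
Hypothesis f_inj : injective f.

Let cnt t1 y t := #|[set j | t1 <= f (y, j) < t]|.

Lemma first_to_reach (D : {set 'I_3}) (y0 : 'I_3) (t1 : nat) : y0 \in D ->
  m <= #|[set j | t1 <= f (y0, j)]| ->
  exists2 y, y \in D & exists2 t, m <= #|[set j | t1 <= f (y, j) < t]| &
    forall y', y' \in D -> #|[set j | t1 <= f (y', j) < t]| <= m.
Proof.
move=> y0D my0.
have exP : exists t, [exists y in D, m <= cnt t1 y t].
  exists N; apply/exists_inP; exists y0 => //; apply: leq_trans my0 _.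
  by apply/subset_leq_card/subsetP => j; rewrite !inE => ->; rewrite ltn_ord.
case: (ex_minnP exP) => t /exists_inP[y yD my] tmin.
exists y => //; exists t => // y' y'D.
case: t tmin {my} => [|t] tmin.
  by rewrite (_ : [set j | _] = set0) ?cards0 //; apply/setP => j; rewrite !inE ltn0 andbF.
have {}tmin : cnt t1 y' t < m.
  rewrite ltnNge; apply/negP => my'; have := tmin t; rewrite ltnn.
  by move=> H; have := H (introT exists_inP (ex_intro2 _ _ y' y'D my')).
apply: leq_trans tmin; rewrite -[leqRHS]addn1.
apply: leq_trans (_ : #|[set j | t1 <= f (y', j) < t] :|: [set j | f (y', j) == t :> nat]| <= _).
  apply/subset_leq_card/subsetP => j; rewrite !inE ltnS => /andP[-> /=].
  by rewrite leq_eqVlt orbC.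
apply: leq_trans (leq_card_setU _ _) _; rewrite leq_add2l.
apply/card_le1_eqP => i j; rewrite !inE => /eqP <- /eqP/val_inj/f_inj[] //.
Qed.

(** Cut at the first threshold where some part has m vertices, then again among the two other parts.
    Each cut costs a remaining part at most m vertices, so the last part still has n - 2m >= m. *)
Lemma ordered_blocks : 3 * m <= n ->
  exists (x y z : 'I_3) (ea eb ec : 'I_m -> 'I_n),
    [/\ [/\ x != y, y != z & x != z],
        [/\ injective ea, injective eb & injective ec],
        forall i j, f (x, ea i) < f (y, eb j) &
        forall j l, f (y, eb j) < f (z, ec l)].
Proof.
move=> m3n.
have all0 y : [set j | 0 <= f (y, j)] = setT by apply/setP => j; rewrite !inE.
have [|x _ [t1 xm small1]] := @first_to_reach setT ord0 0 (in_setT _).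
  by rewrite all0 cardsT card_ord; lia.
have rest1 y : n - m <= #|[set j | t1 <= f (y, j)]|.
  have := cardsC [set j | 0 <= f (y, j) < t1]; rewrite card_ord.
  have -> : ~: [set j | 0 <= f (y, j) < t1] = [set j | t1 <= f (y, j)].
    by apply/setP => j; rewrite !inE -leqNgt.
  by have := small1 y (in_setT _); move: #|_| #|_| => *; lia.
have [y0 y0x] : exists y0, y0 \in ~: [set x].
  by apply/card_gt0P; rewrite cardsCs setCK cards1 card_ord.
have [|y yx [t2 ym small2]] := @first_to_reach (~: [set x]) y0 t1 y0x.
  by apply: leq_trans (rest1 y0); lia.
have [z zxy] : exists z, z \in ~: [set x; y].
  apply/card_gt0P; rewrite cardsCs setCK cards2 card_ord.
  by case: (x != y).
move: (yx) (zxy); rewrite !inE negb_or eq_sym => xy /andP[zx zy].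
have zm : m <= #|[set j | t2 <= f (z, j)]|.
  have zs : z \in ~: [set x] by rewrite !inE.
  have : [set j | t1 <= f (z, j)] \subset
      [set j | t1 <= f (z, j) < t2] :|: [set j | t2 <= f (z, j)].
    by apply/subsetP => j; rewrite !inE => ->; case: ltnP.
  move/subset_leq_card/leq_trans => /(_ _ (leq_card_setU _ _)) le.
  have := leq_trans (rest1 z) (leq_trans le (leq_add (small2 z zs) (leqnn _))).
  by move: #|_| => *; lia.
have [ea ea_inj eaP] := injection_into xm.
have [eb eb_inj ebP] := injection_into ym.
have [ec ec_inj ecP] := injection_into zm.
exists x, y, z, ea, eb, ec; split=> //.
- by rewrite xy eq_sym zy eq_sym zx.
- move=> i j; have := eaP i; have := ebP j; rewrite !inE => /andP[h1 _] /andP[_ h2].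
  exact: leq_trans h2 h1.
- move=> j l; have := ebP j; have := ecP l; rewrite !inE => h1 /andP[_ h2].
  exact: leq_trans h2 h1.
Qed.

End Ordering.

(** In the link of v, two vertices on the same side of v see v as an extreme vertex, so their
    colours are adjacent in F. One of the two sides contains s1 vertices of any K_s, because 2 s1 <=
    s + 1. In the complement the parts need not be ordered, and [ordered_blocks] extracts ordered
    blocks of a third of their size. *)
Lemma two_conditions_lower (V : finType) (F : rel V) (k q N s s1 m n u X Y : nat) :
  symmetric F -> (forall g : 'I_s1 -> V, exists i j, i != j /\ ~~ F (g i) (g j)) ->
  2 * s1 <= s.+1 -> 0 < #|V| ->
  (forall Q : {set V * V}, #|V| ^ 2 < #|Q| * k ->
    exists2 y : {ffun 'I_q -> V * V}, forall i, y i \in Q &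
      #|uncovered F y| * k <= #|V| ^ 2) ->
  n.+1 = 2 * u -> 3 * n.+1 <= m ->
  (#|V| ^ 2) ^ q * 2 ^ n.+1 * X <= k ^ n.+1 ->
  2 ^ (n.+1 ^ 2) * (2 * Y) <= k ^ (2 * u ^ 2) ->
  n.+1 * 2 ^ n.+1 * (2 * Y) <= X ^ u ->
  ramsey_prop (link (K s)) (tripartite m) N -> Y <= N ^ (3 * n.+1).
Proof.
move=> Fsym Fcl s1s V_gt0 cover nu nm hX hY1 hY2 ram.
rewrite leqNgt; apply/negP => NY.
pose i0 : 'I_3 := inord 0; pose i1 : 'I_3 := inord 1; pose i2 : 'I_3 := inord 2.
have i01 : i0 != i1 by rewrite -val_eqE /= !inordK.
have i12 : i1 != i2 by rewrite -val_eqE /= !inordK.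
have i02 : i0 != i2 by rewrite -val_eqE /= !inordK.
pose bad (f : {ffun 'I_3 * 'I_n.+1 -> 'I_N}) := [pred x : {ffun 'I_N * 'I_N -> V} |
  [forall i, forall j, forall l, ~~ two_conditions F x (f (i0, i)) (f (i1, j)) (f (i2, l))]].
have cbad (f : {ffun 'I_3 * 'I_n.+1 -> 'I_N}) : injectiveb f ->
    #|[set x | bad f x]| * Y <= #|V| ^ (N * N).
  move=> /injectiveP f_inj.
  apply: (card_no_ordered_triple (a := fun i => f (i0, i)) (b := fun i => f (i1, i))
    (c := fun i => f (i2, i)) V_gt0 cover _ _ _ _ _ _ nu hX) => //.
  - by move=> i j /f_inj[].
  - by move=> i j /f_inj[].
  - by move=> i j /f_inj[].
  - by move=> i j /f_inj[e _]; move: i01; rewrite e eqxx.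
  - by move=> i j /f_inj[e _]; move: i02; rewrite e eqxx.
  - by move=> i j /f_inj[e _]; move: i12; rewrite e eqxx.
have {cbad} := card_exists cbad.
set B := [set x | _] => cB.
have [|//|x] := @not_all_bad _ V B (N ^ (3 * n.+1)) Y V_gt0.
  rewrite card_prod !card_ord; apply: leq_trans cB _; rewrite leq_mul2r; apply/orP; right.
  by apply: leq_trans (max_card _) _; rewrite card_ffun card_prod !card_ord.
rewrite inE => /existsPn good.
pose P (u v w : 'I_N) := [&& u < v, v < w & two_conditions F x u v w].
case: (ram (triples P)).
  case/link_in_triples=> v [y [y_inj yv yP]].
  pose U := [set i | v < y i].
  have FU i j : i \in U -> j \in U -> i != j -> F (x (v, y i)) (x (v, y j)).
    rewrite !inE => vi vj /yP; rewrite /P /two_conditions.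
    rewrite [y i < v]ltnNge [y j < v]ltnNge (ltnW vi) (ltnW vj) /= ?andbF /= ?orbF.
    by case/orP=> /and3P[_ _ /andP[c1 _]] //; rewrite Fsym.
  have FD i j : i \notin U -> j \notin U -> i != j -> F (x (v, y i)) (x (v, y j)).
    rewrite !inE -!leqNgt => vi vj /yP; rewrite /P /two_conditions.
    rewrite [v < y i]ltnNge [v < y j]ltnNge vi vj /= ?andbF /= ?orbF.
    by case/orP=> /and3P[_ _ /andP[_ c1]] //; rewrite Fsym.
  have noclique (A : {set 'I_s}) : s1 <= #|A| ->
      ~ (forall i j, i \in A -> j \in A -> i != j -> F (x (v, y i)) (x (v, y j))).
    move=> /injection_into[e e_inj eA] FA.
    have [i [j [ij /negP[]]]] := Fcl (fun i => x (v, y (e i))).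
    by apply: FA; rewrite ?eA // (inj_eq e_inj).
  have [Ubig|Usmall] := leqP s1 #|U|; first exact: (noclique U Ubig).
  apply: (noclique (~: U)); last by move=> i j; rewrite !in_setC; apply: FD.
  by have := cardsC U; rewrite card_ord; move: #|U| #|~: U| Usmall => *; lia.
case/tripartite_in_complement=> f f_inj fP.
have [p0 [p1 [p2 [ea [eb [ec [[p01 p12 p02] [ea_inj eb_inj ec_inj] lt01 lt12]]]]]]] :=
  ordered_blocks f_inj nm.
pose g := [ffun y : 'I_3 * 'I_n.+1 =>
  if y.1 == i0 then f (p0, ea y.2) else
  if y.1 == i1 then f (p1, eb y.2) else f (p2, ec y.2)].
have g0 i : g (i0, i) = f (p0, ea i) by rewrite ffunE eqxx.
have g1 i : g (i1, i) = f (p1, eb i) by rewrite ffunE eq_sym (negPf i01) eqxx.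
have g2 i : g (i2, i) = f (p2, ec i).
  by rewrite ffunE eq_sym (negPf i02) eq_sym (negPf i12).
have /negP[] := good g; apply/andP; split.
  have i3 (i : 'I_3) : [\/ i = i0, i = i1 | i = i2].
    case: i => -[|[|[|//]]] Hi; [constructor 1|constructor 2|constructor 3];
    by apply: val_inj; rewrite /= inordK.
  apply/injectiveP => -[i y] [j y'].
  case: (i3 i) => ->; case: (i3 j) => ->; rewrite ?g0 ?g1 ?g2 => /f_inj[] //.
  - by move=> /ea_inj ->.
  - by move=> e; move: p01; rewrite e eqxx.
  - by move=> e; move: p02; rewrite e eqxx.
  - by move=> e; move: p01; rewrite e eqxx.
  - by move=> /eb_inj ->.
  - by move=> e; move: p12; rewrite e eqxx.
  - by move=> e; move: p02; rewrite e eqxx.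
  - by move=> e; move: p12; rewrite e eqxx.
  - by move=> /ec_inj ->.
apply/forallP => i; apply/forallP => j; apply/forallP => l; rewrite g0 g1 g2.
have := fP (p0, ea i) (p1, eb j) (p2, ec l) p01 p12 p02.
by rewrite /P lt01 lt12.
Qed.

(** Greedy choice: pairs meeting U or lying on the diagonal number at most (2|U| + 1)|V|, and each
    chosen pair adds two vertices to U. *)
Lemma distinct_pairs (V : finType) (P : {set V * V}) (q : nat) (U : {set V}) :
  (2 * #|U| + 4 * q + 1) * #|V| < #|P| ->
  exists p : nat -> bool -> V,
    [/\ forall i, i < q -> (p i false, p i true) \in P,
        forall i b, i < q -> p i b \notin U &
        forall i j b b', i < q -> j < q -> p i b = p j b' -> (i, b) = (j, b')].
Proof.
elim: q U => [|q IHq] U Pbig.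
  have /card_gt0P[p0 _] : 0 < #|P| by apply: leq_ltn_trans Pbig.
  by exists (fun _ b => if b then p0.2 else p0.1).
have [[x y] /= xyP /and3P[xU yU xy]] : exists2 p, p \in P &
    [&& p.1 \notin U, p.2 \notin U & p.1 != p.2].
  apply/exists_inP; apply: contraLR Pbig => /exists_inPn none; rewrite -leqNgt.
  have : P \subset setX U setT :|: (setX setT U :|: [set (x, x) | x : V]).
    apply/subsetP => -[x y] /none /=; rewrite !inE /= andbT !negb_and !negbK.
    by case/or3P=> [->//|->|/eqP ->]; rewrite ?orbT // imset_f ?orbT.
  move/subset_leq_card/leq_trans; apply.
  apply: leq_trans (leq_card_setU _ _) _; rewrite cardsX cardsT.
  apply: leq_trans (leq_add (leqnn _) (leq_card_setU _ _)) _; rewrite cardsX cardsT.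
  apply: leq_trans (leq_add (leqnn _) (leq_add (leqnn _) (leq_imset_card _ _))) _.
  by rewrite mulnDl mulnDl mul1n; move: #|V| #|U| => v u; nia.
have [|p [pP pU p_inj]] := IHq (x |: (y |: U)).
  apply: leq_ltn_trans Pbig; rewrite leq_mul2r; apply/orP; right.
  by rewrite !cardsU1; case: (x \notin _); case: (y \notin _); lia.
exists (fun i b => if i is i'.+1 then p i' b else if b then y else x); split.
- by move=> [|i] //= iq; apply: pP.
- case=> [[]|i b] //= iq; have := pU i b iq.
  by rewrite !inE !negb_or => /and3P[].
have new i b : i < q -> (p i b != x) && (p i b != y).
  by move=> /pU - /(_ b); rewrite !inE !negb_or => /and3P[-> ->].
case=> [|i] [|j] b b' iq jq //=.
- by case: b b' => -[] // e; move: xy; rewrite e eqxx.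
- by move=> e; have := new j b' jq; rewrite -e; case: b {e}; rewrite eqxx ?andbF.
- by move=> e; have := new i b iq; rewrite e; case: b' {e}; rewrite eqxx ?andbF.
by move=> /p_inj - /(_ iq jq) [-> ->].
Qed.

(** Cliques and tensor holes on distinct vertices each occur with probability at most 1/4. If Q and
    the set left uncovered by q of its pairs were both large, [distinct_pairs] applied to each would
    give such a hole. The second application avoids the at most 2q vertices of the first, whence 4q
    + 4q + 1 <= 9q. *)
Lemma covering_graph (K : finType) (e0 : {set K}) (M s1 q : nat) :
  0 < #|K| -> 0 < q ->
  4 * (M ^ s1 * #|e0| ^ 'C(s1, 2)) <= #|K| ^ 'C(s1, 2) ->
  4 * (M ^ (4 * q) * (#|K| ^ 2 - #|e0| ^ 2) ^ (q * q)) <= (#|K| ^ 2) ^ (q * q) ->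
  exists F : rel 'I_M, [/\ symmetric F,
    forall g : 'I_s1 -> 'I_M, exists i j, i != j /\ ~~ F (g i) (g j) &
    forall Q : {set 'I_M * 'I_M}, 9 * q * M < #|Q| ->
      exists2 y : {ffun 'I_q -> 'I_M * 'I_M}, forall i, y i \in Q &
        #|uncovered F y| <= 9 * q * M].
Proof.
move=> K_gt0 q_gt0 hcl hte.
pose fT := {ffun {set 'I_M} -> K}.
have cl := card_cliques 'I_M e0 s1; have te := card_tensor_holes 'I_M e0 q.
rewrite !card_ord in cl te.
set B1 := [set f | _] in cl; set B2 := [set f | _] in te.
have [f] : exists f, f \notin B1 :|: B2.
  apply: (@not_all_bad _ _ _ 1 2 K_gt0) => //; rewrite mul1n card_powersets card_ord.
  apply: leq_trans (leq_mul (leq_card_setU B1 B2).1 (leqnn 2)) _.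
  have aux b (x y z w : nat) : 0 < z -> b * z <= x * (y * w) -> 4 * (x * y) <= z -> 4 * b <= w.
    move=> z_gt0 le1 le2; rewrite -(leq_pmul2r z_gt0) -mulnA.
    apply: leq_trans (leq_mul (leqnn 4) le1) _.
    by rewrite !mulnA [w * z]mulnC leq_mul2r -mulnA le2 orbT.
  have b1 := aux _ _ _ _ _ _ cl hcl.
  have b2 := aux _ _ _ _ _ _ te hte.
  have {}b1 : 4 * #|B1| <= #|K| ^ (2 ^ M) by apply: b1; rewrite expn_gt0 K_gt0.
  have {}b2 : 4 * #|B2| <= #|K| ^ (2 ^ M) by apply: b2; rewrite !expn_gt0 K_gt0.
  by move: #|B1| #|B2| (#|K| ^ _) b1 b2 => *; lia.
rewrite !inE negb_or => /andP[/existsPn ncl /existsPn nte].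
pose F := color_graph e0 f; have Firr x : F x x = false := color_graph_irr e0 f x.
have Fsym : symmetric F := color_graph_sym e0 f.
exists F; split=> //.
  move=> g; apply: contrapT => none.
  have Fg i j : i != j -> F (g i) (g j).
    by move=> ij; apply: contraT => nF; case: none; exists i, j.
  have /negP[] := ncl [ffun i => g i]; apply/andP; split.
    apply/injectiveP => i j; rewrite !ffunE => e.
    by apply/eqP; apply: contraT => /Fg; rewrite e Firr.
  by apply/forallP => i; apply/forallP => j; apply/implyP => /Fg; rewrite !ffunE.
move=> Q Qbig.
have [|p [pP _ p_inj]] := @distinct_pairs _ Q q set0.
  apply: leq_ltn_trans Qbig; rewrite cards0 card_ord leq_mul2r; lia.
pose y := [ffun i : 'I_q => (p i false, p i true)].
exists y => [i|]; first by rewrite ffunE; apply: pP.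
rewrite leqNgt; apply/negP => Zbig.
pose U := [set p x.2 x.1 | x : bool * 'I_q].
have cU : #|U| <= 2 * q.
  by apply: leq_trans (leq_imset_card _ _) _; rewrite card_prod card_bool card_ord.
have [|r [rP rU r_inj]] := @distinct_pairs _ (uncovered F y) q U.
  apply: leq_ltn_trans Zbig; rewrite card_ord leq_mul2r.
  by move: #|U| cU => v cU; lia.
pose g := [ffun z : bool * bool * 'I_q => if z.1.1 then r z.2 z.1.2 else p z.2 z.1.2].
have rp (i j : 'I_q) b b' : r i b <> p j b'.
  move=> e; have := rU i b (ltn_ord i); rewrite e => /negP[].
  by apply/imsetP; exists (b', j).
have /negP[] := nte g; apply/andP; split.
  apply/injectiveP => -[[b1 b2] i] [[b1' b2'] j]; rewrite !ffunE /=.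
  case: b1 b1' => -[].
  - by move=> /r_inj - /(_ (ltn_ord i) (ltn_ord j)) [/val_inj -> ->].
  - by move/rp.
  - by move/esym/rp.
  - by move=> /p_inj - /(_ (ltn_ord i) (ltn_ord j)) [/val_inj -> ->].
apply/forallP => i; apply/forallP => j; rewrite !ffunE /=.
have := rP j (ltn_ord j); rewrite inE => /forallP/(_ i); by rewrite ffunE.
Qed.

(** * Choice of parameters *)

(** With k = 2^c and |V| = k^2, the bound 9q <= k turns 9q|V| into at most |V|^2 / k. Blocks have
    size 2u with u = n/6 rounded down, since ordering them costs a factor 3. *)
Lemma covering_graph_lower (K : finType) (e0 : {set K}) (c q n s s1 N : nat) :
  0 < #|K| -> 0 < q -> 12 <= c -> 12 <= n -> 9 * q <= 2 ^ c -> 24 * q <= n ->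
  2 * s1 <= s.+1 ->
  4 * ((2 ^ (2 * c)) ^ s1 * #|e0| ^ 'C(s1, 2)) <= #|K| ^ 'C(s1, 2) ->
  4 * ((2 ^ (2 * c)) ^ (4 * q) * (#|K| ^ 2 - #|e0| ^ 2) ^ (q * q))
    <= (#|K| ^ 2) ^ (q * q) ->
  ramsey_prop (link (Defs.K s)) (tripartite n) N -> 2 ^ (c * n) <= N ^ 144.
Proof.
move=> K_gt0 q_gt0 c12 n12 qc qn s1s hcl hte ram.
pose k := 2 ^ c; pose M := 2 ^ (2 * c); pose u := n %/ 6.
have [F [Fsym Fcl Fcov]] := covering_graph K_gt0 q_gt0 hcl hte.
have ME : M = k * k by rewrite /M mul2n -addnn expnD.
have M_gt0 : 0 < M by rewrite expn_gt0.
have qu : 4 * q <= u by rewrite leq_divRL //; lia.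
have u_gt1 : 1 < u by rewrite leq_divRL.
have un : 6 * u <= n by rewrite mulnC leq_divM.
have nu12 : n <= 12 * u by have := ltn_ceil n (isT : 0 < 6); rewrite -/u; lia.
have uE : (2 * u).-1.+1 = 2 * u by rewrite prednK //; lia.
have small : 9 * q * M * k <= M ^ 2.
  rewrite mulnAC -mulnn leq_mul2r; apply/orP; right.
  by rewrite ME leq_mul2r qc orbT.
have : 2 ^ ((c - 6) * u ^ 2) <= N ^ (3 * (2 * u).-1.+1).
  apply: (@two_conditions_lower 'I_M F k q N s s1 n (2 * u).-1 u (2 ^ ((c - 2) * u)))
    => //; rewrite ?uE ?card_ord //.
  - move=> Q Qk; have [|y yQ yc] := Fcov Q.
      rewrite ltnNge; apply/negP => Qs; move: Qk; rewrite ltnNge => /negP[].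
      by apply: leq_trans small; rewrite leq_mul2r Qs orbT.
    by exists y => //; apply: leq_trans small; rewrite leq_mul2r yc orbT.
  - by rewrite mulnA.
  - rewrite /M /k -!expnM -!expnD leq_pexp2l //.
    have : c * (4 * q) <= c * u by rewrite leq_mul2l qu orbT.
    have -> : (c - 2) * u = c * u - 2 * u by rewrite mulnBl.
    have : 2 * u <= c * u by rewrite leq_mul2r; apply/orP; right; lia.
    have -> : 2 * c * (2 * q) = c * (4 * q) by ring.
    have -> : c * (2 * u) = 2 * (c * u) by ring.
    by move: (c * u) (c * (4 * q)) => *; lia.
  - rewrite -expnS -expnD -expnM leq_pexp2l // expnMn mulnBl.
    have -> : c * (2 * u ^ 2) = 2 * (c * u ^ 2) by ring.
    have : 12 * u ^ 2 <= c * u ^ 2 by rewrite leq_mul2r c12 orbT.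
    have : 0 < u ^ 2 by rewrite expn_gt0 (ltnW u_gt1).
    by move: (u ^ 2) (c * u ^ 2) => *; lia.
  - apply: (@leq_trans (2 ^ (2 * u) * 2 ^ (2 * u) * (2 * 2 ^ ((c - 6) * u ^ 2)))).
      by rewrite leq_mul2r leq_mul2r (ltnW (ltn_expl _ _)) ?orbT.
    rewrite -expnS -!expnD -expnM leq_pexp2l // -mulnA mulnn !mulnBl.
    have : 12 * u ^ 2 <= c * u ^ 2 by rewrite leq_mul2r c12 orbT.
    have : 2 * u <= u ^ 2 by rewrite -mulnn leq_mul2r u_gt1 orbT.
    by move: (u ^ 2) (c * u ^ 2) => *; lia.
rewrite uE => le; have {}le : 2 ^ ((c - 6) * u) <= N ^ 6.
  rewrite -(@leq_exp2r _ _ u) ?(ltnW u_gt1) // -!expnM -[(_ - _) * _ * _]mulnA mulnn.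
  by rewrite (_ : 6 * u = 3 * (2 * u)) // mulnA.
(* The factor 24 comes from c <= 2(c - 6) and n <= 12u. *)
rewrite (_ : 144 = 6 * 24) // [N ^ _]expnM; apply: leq_trans (leq_exp_base 24 le).
rewrite -expnM leq_pexp2l //; apply: leq_trans (leq_mul (leqnn c) nu12) _.
apply: (@leq_trans (2 * (c - 6) * (12 * u))).
  by rewrite leq_mul2r; apply/orP; right; clear -c12; lia.
by rewrite leq_eqVlt; apply/orP; left; apply/eqP; move: (c - 6) (u) => d v; ring.
Qed.

Lemma bin_le_exp2 (n k : nat) : 'C(n, k) <= 2 ^ n.
Proof.
elim: n k => [|n IHn] [|k]; rewrite ?bin0 ?expn_gt0 ?bin0n //.
by rewrite binS expnS mul2n -addnn leq_add.
Qed.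

(** Factor by factor, 2m + s - i <= 2(m + s - i). *)
Lemma bin_double (m s : nat) : 'C(2 * m + s, s) <= 2 ^ s * 'C(m + s, s).
Proof.
rewrite -(leq_pmul2r (fact_gt0 s)) -mulnA !bin_ffact !ffact_prod.
rewrite -[2 ^ s](_ : \prod_(i < s) 2 = _); last by rewrite prod_nat_const card_ord.
by rewrite -big_split /=; apply: leq_prod => i _; have := ltn_ord i; lia.
Qed.

Lemma bin_le_pow2 (i n s : nat) : n <= 2 ^ i * s -> 'C(n + s, s) <= 2 ^ ((i + 2) * s).
Proof.
elim: i n => [|i IHi] n ns.
  apply: leq_trans (_ : 'C(s + s, s) <= _); first by apply: leq_bin2l; lia.
  by rewrite addnn -mul2n; apply: bin_le_exp2.
apply: leq_trans (_ : 'C(2 * (2 ^ i * s) + s, s) <= _).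
  by apply: leq_bin2l; rewrite leq_add2r mulnA -expnS.
apply: leq_trans (bin_double _ _) _.
by rewrite !addSn mulSn expnD leq_mul2l IHi ?orbT.
Qed.

Lemma bin_le_expS (n s : nat) : 'C(n + s, s) <= n.+1 ^ s.
Proof.
elim: s => [|s IHs]; first by rewrite bin0.
rewrite -(leq_pmul2l (ltn0Sn s)) addnS -mul_bin_diag expnS mulnA.
apply: leq_mul => //=; lia.
Qed.

(** Induction on b: the ratio 1 + s/(m + 1) of consecutive terms decreases in m, so it is smaller at
    m = a + b than at m = b. *)
Lemma bin_submult (a b s : nat) : 'C(a + b + s, s) <= 'C(a + s, s) * 'C(b + s, s).
Proof.
have step m : m.+1 * 'C(m.+1 + s, s) = (m.+1 + s) * 'C(m + s, s).
  have -> : 'C(m.+1 + s, s) = 'C(m.+1 + s, m.+1) by rewrite -[in RHS]bin_sub ?leq_addr // addKn.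
  have -> : 'C(m + s, s) = 'C(m + s, m) by rewrite -[in RHS]bin_sub ?leq_addr // addKn.
  by rewrite addSn -mul_bin_diag.
elim: b => [|b IHb]; first by rewrite addn0 add0n binn muln1.
have pos : 0 < (a + b).+1 * b.+1 by [].
rewrite -(leq_pmul2l pos) addnS mulnAC step.
rewrite [leqRHS](_ : _ = (a + b).+1 * 'C(a + s, s) * (b.+1 * 'C(b.+1 + s, s))); last by ring.
rewrite step; apply: leq_trans (_ : (a + b).+1 * (b.+1 + s) * 'C(a + b + s, s) <= _).
  by rewrite mulnAC leq_mul2r; apply/orP; right; nia.
rewrite [leqRHS](_ : _ = (a + b).+1 * (b.+1 + s) * ('C(a + s, s) * 'C(b + s, s))); last by ring.
by rewrite leq_mul2l IHb orbT.
Qed.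

(** * The two regimes for large s *)

Lemma bin2_lower (s x : nat) : 2 * x < s -> s * x <= 'C(s, 2).
Proof.
case: s => // s xs; rewrite -(leq_pmul2l (isT : 0 < 2)) -mul_bin_diag bin1 mulnCA.
by rewrite leq_mul2l.
Qed.

Lemma linear_le_exp2 (x : nat) : 20 <= x -> 99 * x <= 2 ^ (x - 3).
Proof.
move=> x20; rewrite -(subnK x20); elim: (x - 20) => [|y IHy].
  by apply: (@leq_trans (2 ^ 11)) => //; rewrite leq_pexp2l.
have -> : y.+1 + 20 - 3 = (y + 20 - 3).+1 by lia.
by rewrite expnS; lia.
Qed.

(* The graph F has 2^(2 c) vertices and density 2^-j, where 8^j is about n / s. *)
Lemma sparse_regime_lower : exists s0 D, forall s n N, s0 <= s -> s <= n ->
  ramsey_prop (link (K s)) (tripartite n) N -> 'C(n + s, s) ^ n <= N ^ D.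
Proof.
(* The factor 144 comes from [covering_graph_lower]; the rest from the bound 2^((3j + 2)s) on the
   binomial coefficient, with 3j + 2 <= 5j and s <= 4400 r. *)
exists (20 * 2200), (144 * (5 * (2 * 2200))) => s n N s0s sn ram.
pose r := s %/ 2200; pose j' := trunc_log 8 (n %/ s); pose j := j'.+1.
have r20 : 20 <= r by rewrite leq_divRL.
have rs : r * 2200 <= s by rewrite leq_divM.
have sr : s <= r * (2 * 2200).
  have := ltn_ceil s (isT : 0 < 2200); rewrite -/r mulSn => /ltnW/leq_trans; apply.
  have : 2200 <= r * 2200 by rewrite leq_pmull // (leq_trans _ r20).
  by rewrite [2 * _]mul2n -addnn mulnDr; move: (r * 2200) => y; rewrite leq_add2r.
have s_gt0 : 0 < s by rewrite (leq_trans _ rs) // muln_gt0 (leq_trans _ r20).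
have Q_gt0 : 0 < n %/ s by rewrite divn_gt0.
have js : 8 ^ j' * s <= n by rewrite -leq_divRL // trunc_logP.
have nj : n <= 2 ^ (3 * j) * s.
  by rewrite ltnW // expnM -ltn_divLR //; apply: trunc_log_ltn.
pose kc := 2 ^ j; pose c := j * r; pose q := 2 ^ (2 * j) * (8 * c + 3).
have q_gt0 : 0 < q by rewrite muln_gt0 expn_gt0 addn_gt0 orbT.
have c20 : 20 <= c by rewrite (leq_trans r20) // leq_pmull.
have q_le : q <= 11 * r * 2 ^ (3 * j).
  apply: (@leq_trans (2 ^ (2 * j) * (11 * (2 ^ j * r)))).
    rewrite leq_mul2l; apply/orP; right.
    apply: (@leq_trans (11 * c)); first by move: (c) c20 => y; clear; lia.
    by rewrite !leq_mul2l leq_mul2r (ltnW (ltn_expl _ _)) ?orbT.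
  rewrite (_ : 3 * j = 2 * j + j) ?expnD; last by rewrite !mulSn; lia.
  by rewrite leq_eqVlt; apply/orP; left; apply/eqP; move: (2 ^ _) (2 ^ j) (r) => *; ring.
pose s1 := s.+1 %/ 2.
have s1s : 2 * s1 <= s.+1 by rewrite mulnC leq_divM.
have s1r : 2 * (2 * r + 2) < s1.
  rewrite leq_divRL //; apply: leq_trans (_ : r * 2200 <= _); last exact: ltnW.
  by move: (r) r20 => y; lia.
have main : 2 ^ (c * n) <= N ^ 144.
  have K0 : 0 < kc by rewrite expn_gt0.
  apply: (@covering_graph_lower 'I_kc [set Ordinal K0] c q n s s1 N) => //.
  - by rewrite card_ord.
  - by rewrite (leq_trans _ c20).
  - by rewrite (leq_trans _ sn) // (leq_trans _ rs) // (leq_trans _ (leq_mul r20 (leqnn _))).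
  - apply: leq_trans (leq_mul (leqnn 9) q_le) _; rewrite !mulnA.
    apply: (@leq_trans (2 ^ (r - 3) * 2 ^ (3 * j))).
      by rewrite leq_mul2r linear_le_exp2 ?orbT.
    rewrite -expnD leq_pexp2l // /c -{2}(subnK (leq_trans (isT : 3 <= 20) r20)) mulnDr [j * 3]mulnC.
    by rewrite leq_add2r leq_pmull.
  - apply: leq_trans (leq_mul (leqnn 24) q_le) _; apply: leq_trans js.
    rewrite expnM -[2 ^ 3]/8 expnS; apply: (@leq_trans (8 ^ j' * (r * 2200))); last first.
      by rewrite leq_mul2l rs orbT.
    by move: (8 ^ j') (r) => x y; nia.
  - rewrite cards1 exp1n muln1 card_ord -expnM -[4]/(2 ^ 2) -expnD -expnM leq_pexp2l //.
    apply: leq_trans (leq_mul (leqnn j) (bin2_lower s1r)).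
    rewrite /c; move: (s1) s1r (j) (isT : 0 < j) (r) => x x0 y y0 r'; nia.
  rewrite cards1 exp1n card_ord subn1.
  apply: leq_trans (@half_power (kc ^ 2) (q * (8 * c + 3)) (q * q) _ _).
  - rewrite mulnA leq_mul2r; apply/orP; right.
    rewrite -expnM -[4]/(2 ^ 2) -expnD leq_pexp2l //.
    by move: (c) (q) q_gt0 => x y y0; nia.
  - by rewrite expn_gt0 K0.
  by rewrite /kc -expnM [j * 2]mulnC mulnCA -/q.
rewrite [N ^ _]expnM; apply: leq_trans (leq_exp_base _ main).
apply: leq_trans (leq_exp_base _ (bin_le_pow2 nj)) _.
rewrite -!expnM leq_pexp2l //.
rewrite [leqRHS](_ : _ = 5 * j * (r * (2 * 2200)) * n); last first.
  by rewrite /c; move: (j) (r) (2 * 2200) => *; ring.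
rewrite leq_mul2r; apply/orP; right; apply: leq_mul => //; rewrite /j; lia.
Qed.

(* The graph F has 2^(2 c) vertices and density 1 - 2^-j, where 4^j is about s / n. *)
Lemma dense_regime_lower : exists n0 D, forall s n N, n0 <= n -> n <= s ->
  ramsey_prop (link (K s)) (tripartite n) N -> 'C(n + s, s) ^ n <= N ^ D.
Proof.
exists (20 * 600), (144 * (3 * (2 * 600))) => s n N n0n ns ram.
(* Excluding cliques at density 1 - 2^-j requires 2^j (2c + 2), of order at most r 4^j, to be a
   small fraction of s; hence the base 4. The shift by two gives j >= 2, so that j - 1 >= j/2
   below. *)
pose r := n %/ 600; pose j' := trunc_log 4 (s %/ n); pose j := j'.+2.
have r20 : 20 <= r by rewrite leq_divRL.
have rn : r * 600 <= n by rewrite leq_divM.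
have nr : n <= r * (2 * 600).
  have := ltn_ceil n (isT : 0 < 600); rewrite -/r mulSn => /ltnW/leq_trans; apply.
  have : 600 <= r * 600 by rewrite leq_pmull // (leq_trans _ r20).
  by rewrite [2 * _]mul2n -addnn mulnDr; move: (r * 600) => y; rewrite leq_add2r.
have n_gt0 : 0 < n by rewrite (leq_trans _ rn) // muln_gt0 (leq_trans _ r20).
have Q_gt0 : 0 < s %/ n by rewrite divn_gt0.
have js : 4 ^ j' * n <= s by rewrite -leq_divRL // trunc_logP.
have sj : s <= 2 ^ (2 * j) * n.
  rewrite expnM; apply: (@leq_trans (4 ^ j'.+1 * n)).
    by rewrite ltnW // -ltn_divLR //; apply: trunc_log_ltn.
  by rewrite leq_mul2r leq_pexp2l ?orbT.
(* A pair of edges fails with probability at most 2^(1 - j), so tensor holes are excluded once (j -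
   1)q^2 >= 8cq + 2. Since j - 1 >= j/2 and c = j r, the value q = 16r + 2 suffices. *)
pose kc := 2 ^ j; pose c := j * r; pose q := 16 * r + 2.
have q_gt0 : 0 < q by rewrite addn_gt0 orbT.
have c40 : 40 <= c by rewrite (leq_trans (leq_mul (isT : 2 <= j) r20)).
pose s1 := s.+1 %/ 2; pose x := 2 ^ j * (2 * c + 2).
have s1s : 2 * s1 <= s.+1 by rewrite mulnC leq_divM.
have xs1 : 2 * x < s1.
  have x_le : x <= 48 * (r * 4 ^ j').
    apply: (@leq_trans (2 ^ j * (3 * (2 ^ j * r)))).
      rewrite leq_mul2l; apply/orP; right.
      apply: (@leq_trans (3 * c)); first by move: (c) c40 => y; clear; lia.
      by rewrite !leq_mul2l leq_mul2r (ltnW (ltn_expl _ _)) ?orbT.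
    rewrite mulnCA [2 ^ j * (_ * _)]mulnA -expnMn /j !expnS -[2 * 2]/4.
    by move: (4 ^ j') (r) => y z; clear; lia.
  have s_ge : 600 * (r * 4 ^ j') <= s.
    by apply: leq_trans js; rewrite mulnA mulnC leq_mul2l [600 * r]mulnC rn orbT.
  have y0 : 0 < r * 4 ^ j' by rewrite muln_gt0 expn_gt0 (leq_trans _ r20).
  rewrite leq_divRL //; move: (x) (r * 4 ^ j') x_le s_ge y0 => a b; clear; lia.
have main : 2 ^ (c * n) <= N ^ 144.
  have K0 : 0 < kc by rewrite expn_gt0.
  have card_e0 : #|~: [set Ordinal K0]| = kc.-1.
    by rewrite cardsCs setCK cards1 card_ord subn1.
  apply: (@covering_graph_lower 'I_kc (~: [set Ordinal K0]) c q n s s1 N) => //.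
  - by rewrite card_ord.
  - by rewrite (leq_trans _ c40).
  - by rewrite (leq_trans _ rn) // (leq_trans _ (leq_mul r20 (leqnn _))).
  - apply: (@leq_trans (2 * (99 * r))); first by rewrite /q; move: (r) r20 => y; clear; lia.
    apply: leq_trans (leq_mul (leqnn 2) (linear_le_exp2 r20)) _.
    rewrite -expnS leq_pexp2l // /c; apply: (@leq_trans r).
      by move: (r) r20 => y; clear; lia.
    by rewrite leq_pmull.
  - apply: leq_trans rn; rewrite /q; move: (r) r20 => y; clear; lia.
  - rewrite card_e0 card_ord.
    apply: leq_trans (@half_power kc (2 * c * s1 + 2) 'C(s1, 2) K0 _).
      by rewrite mulnA leq_mul2r -expnM -[4]/(2 ^ 2) -expnD addnC leqnn orbT.
    apply: leq_trans (bin2_lower xs1); rewrite /x mulnCA /kc leq_mul2l; apply/orP; right.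
    move: (s1) xs1 (c) => a a0 b; have {a0} : 0 < a by apply: leq_ltn_trans a0.
    clear; nia.
  rewrite card_e0 card_ord.
  have sq : kc ^ 2 - kc.-1 ^ 2 <= 2 ^ j.+1.
    have -> : 2 ^ j.+1 = 2 * kc by rewrite expnS.
    move: (kc) (K0) => [//|y] _; rewrite -!mulnn leq_subLR -[y.+1.-1]/y.
    by rewrite mulSn mulnS; move: (y * y) => w; clear; lia.
  apply: leq_trans (leq_mul (leqnn 4) (leq_mul (leqnn _) (leq_exp_base _ sq))) _.
  rewrite -[4]/(2 ^ 2) /kc -!expnM -!expnD leq_pexp2l //.
  have -> : 2 * c * (4 * q) = 8 * (j * (r * q)) by rewrite /c; move: (j) (r) (q) => *; ring.
  have -> : j * (2 * (q * q)) = j * (q * q) + (16 * (j * (r * q)) + 2 * (j * q)).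
    by rewrite /q; move: (j) (r) => a b; ring.
  rewrite [j.+1 * _]mulSn.
  have : q * q + 2 <= 8 * (j * (r * q)) + 2 * (j * q).
    apply: (@leq_trans (8 * (2 * (r * q)) + 2 * (2 * q))).
      rewrite {1}/q mulnDl; move: (r * q) (q) q_gt0 => *; lia.
    by apply: leq_add; rewrite leq_mul2l /= leq_mul2r ?orbT.
  by move: (q * q) (j * (q * q)) (j * (r * q)) (j * q) => *; lia.
rewrite [N ^ _]expnM; apply: leq_trans (leq_exp_base _ main).
have -> : 'C(n + s, s) = 'C(s + n, n) by rewrite -bin_sub ?leq_addl // addnK addnC.
apply: leq_trans (leq_exp_base _ (bin_le_pow2 sj)) _.
rewrite -!expnM leq_pexp2l //.
rewrite [leqRHS](_ : _ = 3 * j * (r * (2 * 600)) * n); last first.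
  by rewrite /c; move: (j) (r) (2 * 600) => *; ring.
rewrite leq_mul2r; apply/orP; right; apply: leq_mul => //; rewrite /j; clear; lia.
Qed.

(** * Upper bound and conclusion *)

(** The complement of the complete 3-graph has no edges, so the complete 3-graph must contain the
    link, which has s + 1 vertices. *)
Lemma ramsey_prop_gt (s n N : nat) : 0 < n ->
  ramsey_prop (link (K s)) (tripartite n) N -> s < N.
Proof.
move=> n_gt0 ram; case: (ram (triples (fun _ _ _ => true))).
  by case=> f /leq_card + _; rewrite card_option !card_ord.
case/tripartite_in_complement=> f _ fP; pose o : 'I_n := Ordinal n_gt0.
by have := fP (inord 0, o) (inord 1, o) (inord 2, o);
  rewrite -!val_eqE /= !inordK // => /(_ isT isT isT).
Qed.

(** Large n is split into s < s0, s0 <= s <= n and n < s. For n < n0 the inequality N > s suffices,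
    since C(n + s, n) <= (s + 1)^n. For s < s0 the coefficient is at most (n + 1)^s <= n^(2s). *)
Lemma lower_bound : exists2 D, 0 < D & forall s n N, 2 < s -> 0 < n ->
  ramsey_prop (link (K s)) (tripartite n) N -> 'C(n + s, s) ^ n <= N ^ D.
Proof.
have [nA [DA lowA]] := small_clique_lower.
have [s0 [DB lowB]] := sparse_regime_lower.
have [nC [DC lowC]] := dense_regime_lower.
pose n0 := (nA + nC).+2.
exists ((n0 * n0 + DA * (2 * s0)) + (DB + DC)).+1 => // s n N s3 n_gt0 ram.
have N_gt0 : 0 < N := leq_ltn_trans (leq0n _) (ramsey_prop_gt n_gt0 ram).
have up d : d <= (n0 * n0 + DA * (2 * s0)) + (DB + DC) ->
    N ^ d <= N ^ ((n0 * n0 + DA * (2 * s0)) + (DB + DC)).+1.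
  by move=> dle; rewrite leq_pexp2l // ltnW.
have [nn0|n0n] := ltnP n n0.
  apply: leq_trans (up (n0 * n0) _); last by rewrite -addnA leq_addr.
  have -> : 'C(n + s, s) = 'C(s + n, n) by rewrite -bin_sub ?leq_addl // addnK addnC.
  apply: leq_trans (leq_exp_base _ (bin_le_expS s n)) _; rewrite -expnM.
  apply: (@leq_trans (N ^ (n * n))); first exact: leq_exp_base (ramsey_prop_gt n_gt0 ram).
  by rewrite leq_pexp2l // leq_mul // ltnW.
have nAn : nA <= n by apply: leq_trans n0n; rewrite /n0; lia.
have nCn : nC <= n by apply: leq_trans n0n; rewrite /n0; lia.
have [ss0|s0s] := ltnP s s0.
  apply: leq_trans (up (DA * (2 * s0)) _); last by rewrite addnAC leq_addl.
  apply: (@leq_trans (((n ^ 2) ^ s) ^ n)); last first.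
    have -> : ((n ^ 2) ^ s) ^ n = (n ^ n) ^ (2 * s) by rewrite -!expnM; congr (n ^ _); ring.
    apply: leq_trans (leq_exp_base _ (lowA _ _ _ s3 nAn ram)) _; rewrite -expnM.
    by rewrite leq_pexp2l // !leq_mul2l (ltnW ss0) !orbT.
  apply: leq_exp_base; apply: leq_trans (bin_le_expS n s) _.
  by apply: leq_exp_base; rewrite -mulnn; move: n0n; rewrite /n0; nia.
have [sn|ns] := leqP s n.
  apply: leq_trans (lowB _ _ _ s0s sn ram) (up _ _).
  by rewrite addnA addnAC leq_addl.
apply: leq_trans (lowC _ _ _ nCn (ltnW ns) ram) (up _ _).
by rewrite addnA leq_addl.
Qed.

(** The Erdos-Szekeres recursion: for v in A, Pascal's rule makes either the neighbours or the
    non-neighbours of v in A numerous enough. *)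
Lemma clique_or_independent (T : finType) (e : rel T) (a b : nat) (A : {set T}) :
  symmetric e -> 'C(a + b, a) <= #|A| ->
  exists S : {set T}, S \subset A /\
   ((#|S| = a /\ {in S &, forall x y, x != y -> e x y}) \/
    (#|S| = b /\ {in S &, forall x y, x != y -> ~~ e x y})).
Proof.
move=> e_sym; elim: a b A => [|a IHa] b A.
  by exists set0; rewrite sub0set; split=> //; left; split; [rewrite cards0|move=> x y; rewrite inE].
elim: b A => [|b IHb] A Abig.
  by exists set0; rewrite sub0set; split=> //; right; split; [rewrite cards0|move=> x y; rewrite inE].
have [v vA] : exists v, v \in A.
  by apply/card_gt0P; apply: leq_trans Abig; rewrite bin_gt0 leq_addr.
pose A1 := [set x in A :\ v | e v x]; pose A2 := [set x in A :\ v | ~~ e v x].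
have cA : #|A| = (#|A1| + #|A2|).+1.
  rewrite (cardsD1 v) vA add1n -(cardsID [set x | e v x] (A :\ v)); congr (_ + _).+1.
    by apply: eq_card => x; rewrite !inE.
  by apply: eq_card => x; rewrite !inE andbC.
have A1A x : x \in A1 -> [/\ x \in A, x != v & e v x].
  by rewrite !inE => /andP[/andP[-> ->] ->].
have A2A x : x \in A2 -> [/\ x \in A, x != v & ~~ e v x].
  by rewrite !inE => /andP[/andP[-> ->] ->].
have [big1|small1] := leqP 'C(a + b.+1, a) #|A1|.
  have [S [/subsetP SA1 cases]] := IHa b.+1 A1 big1.
  case: cases => -[cS PS]; last first.
    by exists S; split; [apply/subsetP => x /SA1/A1A[]|right].
  have vS : v \notin S by apply/negP => /SA1/A1A[]; rewrite eqxx.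
  exists (v |: S); split.
    by rewrite subUset sub1set vA; apply/subsetP => x /SA1/A1A[].
  left; split; first by rewrite cardsU1 vS cS.
  move=> x y; rewrite !inE => /predU1P[->|xS] /predU1P[->|yS]; rewrite ?eqxx //.
  - by move=> _; have [] := A1A _ (SA1 _ yS).
  - by move=> _; rewrite e_sym; have [] := A1A _ (SA1 _ xS).
  exact: PS.
have big2 : 'C(a.+1 + b, a.+1) <= #|A2|.
  by move: Abig small1; rewrite cA addnS binS addSnnS; move: #|A1| #|A2| => *; lia.
have [S [/subsetP SA2 cases]] := IHb A2 big2.
case: cases => -[cS PS].
  by exists S; split; [apply/subsetP => x /SA2/A2A[]|left].
have vS : v \notin S by apply/negP => /SA2/A2A[]; rewrite eqxx.
exists (v |: S); split.
  by rewrite subUset sub1set vA; apply/subsetP => x /SA2/A2A[].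
right; split; first by rewrite cardsU1 vS cS.
move=> x y; rewrite !inE => /predU1P[->|xS] /predU1P[->|yS]; rewrite ?eqxx //.
- by move=> _; have [] := A2A _ (SA2 _ yS).
- by move=> _; rewrite e_sym; have [] := A2A _ (SA2 _ xS).
exact: PS.
Qed.

Lemma tripartite_edge (n : nat) (e : {set 'I_3 * 'I_n}) : e \in edges (tripartite n) ->
  exists i j l, e = [set (inord 0, i); (inord 1, j); (inord 2, l)].
Proof.
rewrite inE => /andP[/eqP e3 /forallP e1].
have pick p : exists i, (p, i) \in e.
  have /cards1P[[p' i] eq1] := e1 p; exists i.
  have : (p', i) \in [set x in e | x.1 == p] by rewrite eq1 inE.
  by rewrite inE => /andP[h /eqP <-].
have [[i ie] [j je] [l le]] := And3 (pick (inord 0)) (pick (inord 1)) (pick (inord 2)).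
exists i, j, l; apply/eqP; rewrite eq_sym eqEcard !subUset !sub1set ie je le e3.
by rewrite cards3 // xpair_eqE -val_eqE /= !inordK.
Qed.

Lemma ramsey_prop_upper (s n : nat) (M := 'C(s + (n + n), s)) :
  ramsey_prop (link (K s)) (tripartite n) (M + (n * 'C(M, n + n)).+1).
Proof.
set N := (M + _) => G.
pose e u := [rel v w : 'I_N | [set u; v; w] \in edges G].
have e_sym u : symmetric (e u) by move=> v w; rewrite /= setUAC.
pose A := [set v : 'I_N | v < M].
have MN : M <= N by rewrite leq_addr.
have cA : #|A| = M.
  rewrite -[RHS]card_ord -(card_imset _ (_ : injective (widen_ord MN))); last first.
    by move=> i j /(congr1 val) /= /val_inj.
  apply: eq_card => v; rewrite inE; apply/idP/imsetP; last by case=> i _ -> /=.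
  by move=> vM; exists (Ordinal vM) => //; apply: val_inj.
pose good u (S : {set 'I_N}) := [/\ S \subset A, #|S| = n + n &
  {in S &, forall x y, x != y -> ~~ e u x y}].
have [[u [uA [S [SA [cS PS]]]]]|none] := EM (exists u, u \notin A /\
    exists S : {set 'I_N}, [/\ S \subset A, #|S| = s & {in S &, forall x y, x != y -> e u x y}]).
  left; have [|x x_inj xS] := @injection_into _ S s; first by rewrite cS.
  have xu i : x i != u.
    by apply: contra uA => /eqP <-; apply: (subsetP SA).
  exists (fun o => if o is Some i then x i else u).
    move=> [i|] [j|] //; first by move/x_inj ->.
    - by move=> e1; move: (xu i); rewrite e1 eqxx.
    - by move=> e1; move: (xu j); rewrite -e1 eqxx.
  move=> _ /imsetP[d + ->]; rewrite inE => /cards2P[i [j [ij ->]]].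
  rewrite imsetU1 imset_set1 !imsetU1 imset_set1 setUA.
  by apply: PS; rewrite ?xS // (inj_eq x_inj).
right; have Sex u : exists S : {set 'I_N}, u \notin A -> good u S.
  have [uA|uA] := boolP (u \in A); first by exists set0.
  have [|S [SA [[cS PS]|[cS PS]]]] := @clique_or_independent _ (e u) s (n + n) A (e_sym u).
  - by rewrite cA.
  - by case: none; exists u; split=> //; exists S.
  by exists S.
have [g gP] := choice Sex.
pose T := [set S : {set 'I_N} | (S \subset A) && (#|S| == n + n)].
have cT : #|T| = 'C(M, n + n) by rewrite cards_draws cA.
have [S SW] : exists S, n <= #|[set u in ~: A | g u == S]|.
  apply/existsP; apply: contraT; rewrite negb_exists => /forallP small.
  have : #|~: A| <= n * #|T|.
    rewrite -sum1_card (partition_big g (mem T)) /=; last first.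
      move=> u; rewrite inE => /gP[SA cS _]; by rewrite inE SA cS eqxx.
    rewrite mulnC -sum_nat_const; apply: leq_sum => S _; rewrite sum1dep_card.
    by have := small S; rewrite -ltnNge => /ltnW.
  have := cardsC A; rewrite cA card_ord cT /N => /addnI ->.
  by rewrite ltnn.
have [w w_inj wW] := injection_into SW.
have [n0|n_gt0] := posnP n.
  subst n; exists (fun x : 'I_3 * 'I_0 => let: (_, i) := x in w i).
    by move=> [i [j]].
  by move=> d /tripartite_edge[[]].
have wA i : w i \notin A by have := wW i; rewrite !inE => /andP[].
have gw i : g (w i) = S by have := wW i; rewrite !inE => /andP[_ /eqP].
have [SA cS _] := gP _ (wA (Ordinal n_gt0)); rewrite gw in SA cS.
have [|y y_inj yS] := @injection_into _ S (n + n); first by rewrite cS.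
have ind i p r : p != r -> [set w i; y p; y r] \notin edges G.
  have [_ _ PS] := gP _ (wA i) => pr; apply: PS; rewrite ?gw //.
  by rewrite (inj_eq y_inj).
have wy i p : w i <> y p.
  by move=> e1; have := wA i; rewrite e1 (subsetP SA).
have lr (i j : 'I_n) : lshift n i <> rshift n j.
  by move/(congr1 val) => /= e1; have := ltn_ord i; rewrite e1 ltnNge leq_addr.
(* The n vertices sharing the independent set S form the first part, and the two halves of S the
   others. *)
pose f (x : 'I_3 * 'I_n) := if x.1 == 0 :> nat then w x.2 else
  if x.1 == 1 :> nat then y (lshift n x.2) else y (rshift n x.2).
have f_inj : injective f.
  move=> [[[|[|[|//]]] Hi] i] [[[|[|[|//]]] Hj] j]; rewrite /f /=;
    do ?[by move/wy|by move/esym/wy|by move/y_inj/lr|by move/y_inj/esym/lr].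
  - by move/w_inj ->; congr (_, _); apply: val_inj.
  - by move/y_inj/lshift_inj ->; congr (_, _); apply: val_inj.
  - by move/y_inj/rshift_inj ->; congr (_, _); apply: val_inj.
exists f => // d de; rewrite inE card_imset // (edges_card de) eqxx /=.
have [i [j [l ->]]] := tripartite_edge de.
rewrite imsetU !imsetU1 !imset_set1 /f /= !inordK //=.
by apply: ind; apply/eqP/lr.
Qed.

Lemma bin_le_exp (a b : nat) : 'C(a, b) <= a ^ b.
Proof.
apply: (@leq_trans ('C(a, b) * b`!)); first by rewrite leq_pmulr ?fact_gt0.
rewrite bin_ffact ffact_prod -[b in a ^ b]card_ord -prod_nat_const.
by apply: leq_prod => i _; rewrite leq_subr.
Qed.

(** By submultiplicativity M <= B^2, so n C(M, 2n) <= B^(4n + 1). The sum of all terms is at most 4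
    B^(4n + 1), and B >= 4 absorbs the constant. *)
Lemma upper_bound (s n : nat) : 2 < s -> 0 < n ->
  exists2 N, ramsey_prop (link (K s)) (tripartite n) N & N <= 'C(n + s, s) ^ (6 * n).
Proof.
move=> s3 n_gt0; have := @ramsey_prop_upper s n.
set M := 'C(s + (n + n), s) => ram; exists (M + (n * 'C(M, n + n)).+1) => //.
set B := 'C(n + s, s).
have B4 : 4 <= B.
  apply: leq_trans (_ : 'C(1 + s, s) <= _); first by rewrite add1n binSn.
  by rewrite leq_bin2l // leq_add2r.
have nB : n <= B.
  rewrite /B -bin_sub ?leq_addl // addnK addnC.
  apply: leq_trans (_ : 'C(1 + n, n) <= _); first by rewrite add1n binSn.
  by rewrite leq_bin2l // leq_add2r (ltnW (ltnW s3)).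
have B_gt0 : 0 < B by apply: leq_trans B4.
have MB : M <= B ^ 2 by rewrite -mulnn /M addnC; apply: bin_submult.
have CB : n * 'C(M, n + n) <= B ^ (4 * n).+1.
  rewrite expnS; apply: leq_mul => //; apply: leq_trans (bin_le_exp _ _) _.
  apply: leq_trans (leq_exp_base _ MB) _; rewrite -expnM leq_pexp2l //; lia.
have P1 : B ^ 2 <= B ^ (4 * n).+1 by rewrite leq_pexp2l //; lia.
have P2 : 0 < B ^ (4 * n).+1 by rewrite expn_gt0 B_gt0.
apply: (@leq_trans (B * B ^ (4 * n).+1)).
  apply: leq_trans (leq_mul B4 (leqnn _)).
  move: (M) (n * 'C(M, n + n)) (B ^ 2) (B ^ (4 * n).+1) P1 P2 MB CB => w x y z; clear; lia.
by rewrite -expnS leq_pexp2l //; lia.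
Qed.

Import Order.TTheory GRing.Theory Num.Theory.
Local Open Scope ring_scope.

Theorem theorem1p5 (R : realType) :
  exists c C : R, [/\ 0 < c, 0 < C &
    forall s n : nat, (3 <= s)%N -> (1 <= n)%N ->
      exists2 N : nat,
        is_ramsey_number (link (K s)) (tripartite n) N &
        ('C(n + s, s))%:R `^ (c * n%:R) <= N%:R
          <= ('C(n + s, s))%:R `^ (C * n%:R)].
Proof.
have [D D_gt0 low] := lower_bound.
have D0 : 0 < D%:R :> R by rewrite ltr0n.
(* [lower_bound] reads B^n <= N^D, so taking D-th roots gives c = 1/D; the value 6 is the exponent
   of [upper_bound]. *)
exists D%:R^-1, 6; split; rewrite ?invr_gt0 // => s n s3 n_gt0.
have [N0 ram0 N0le] := upper_bound s3 n_gt0.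
have exN : exists N, `[< ramsey_prop (link (K s)) (tripartite n) N >].
  by exists N0; apply/asboolP.
case: (ex_minnP exN) => N /asboolP ram Nmin; exists N.
  by split=> // M ramM; apply: Nmin; apply/asboolP.
set B : R := ('C(n + s, s))%:R; have B0 : 0 <= B by rewrite ler0n.
apply/andP; split; last first.
  apply: (@le_trans _ _ N0%:R); first by rewrite ler_nat Nmin //; apply/asboolP.
  by rewrite -natrM powR_mulrn // -natrX ler_nat.
have N_ge0 : 0 <= N%:R :> R by rewrite ler0n.
have -> : N%:R = (N%:R ^+ D) `^ D%:R^-1 :> R.
  by rewrite -powR_mulrn // -powRrM divff ?powRr1 // gt_eqF.
rewrite mulrC powRrM powR_mulrn // ge0_ler_powR ?nnegrE ?exprn_ge0 ?invr_ge0 ?ler0n //.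
by rewrite -!natrX ler_nat low.
Qed.
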